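(* For every $n\geq2$, the morphism $\Delta^{n,1}:\mathrm{Inv}_{norm}(I^{n,1},A)\to\mathrm{Inv}_{norm}(I^{n-1},A)$ is an isomorphism (of $A(k)$-modules).
   Context: Setting. $k$ is a field of characteristic $\neq 2$; $K,L$ denote field extensions of $k$. Quadratic forms are nondegenerate. $GW(K)$, $W(K)$ are the Grothendieck–Witt and Witt rings; $\hat I(K)\subset GW(K)$ is the ideal of elements of virtual dimension $0$ and $I(K)\subset W(K)$ the fundamental ideal; the projection $\hat I(K)\to I(K)$ is an isomorphism, and $\hat I^n(K)$ and $I^n(K)$ are identified. $\langle\langle a\rangle\rangle=\langle1\rangle-\langle a\rangle\in\hat I(K)$, $\langle\langle a_1,\dots,a_n\rangle\rangle=\prod\langle\langle a_i\rangle\rangle$, and $\mathrm{Pf}_n(K)$ is the set of these $n$-fold Pfister elements. For functors $F$ (to sets) and $H$ (to abelian groups) on field extensions of $k$, $\mathrm{Inv}(F,H)$ is the group of natural transformations $F\to H$; if $F$ is pointed, $\mathrm{Inv}_{norm}(F,H)$ is the subgroup of those sending the base point to $0$. $A$ is a functor from field extensions of $k$ to filtered commutative rings $A(K)=A^0(K)\supset A^1(K)\supset\cdots$, with $\bigcap_nA^n(K)=0$, together with a natural map $f_1:I(K)\to A^1(K)$ such that: (i) $\langle\langle a_1,\dots,a_n\rangle\rangle\mapsto\{a_1,\dots,a_n\}:=f_1(\langle\langle a_1\rangle\rangle)\cdots f_1(\langle\langle a_n\rangle\rangle)$ is a well-defined injective map $\mathrm{Pf}_n(K)\to A^n(K)$;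 (ii) for all $n\geq1$ this map extends to a group morphism $f_n:I^n(K)\to A^n(K)$; (iii) if $x\in A(K)$ satisfies $\{a\}\cdot x\in A^{d+1}(L)$ for all extensions $L/K$ and all $a\in L^*$, then $x\in A^d(K)$; (iv) for all $K$ and $n\geq 1$, every invariant of $\mathrm{Pf}_n$ over $K$ (i.e. on extensions of $K$) with values in $A$ is uniquely of the form $x+y f_n$ with $x,y\in A(K)$. (Examples: $A=W$ with $f_1=\mathrm{Id}$; $A=H^*(-,\mu_2)$ with $f_1=e_1$.) For $0\leq r<n$ let $I^{n,r}(K)=\{\varphi\cdot q\mid\varphi\in\mathrm{Pf}_r(K),\,q\in I^{n-r}(K)\}\subset I^n(K)$, pointed by $0$. The morphism $\Delta^{n,1}$, $\alpha\mapsto\alpha^{(1)}$, is the unique ($A(k)$-linear, injective) map such that $\alpha(\varphi\cdot q)=f_1(\varphi)\cdot\alpha^{(1)}(q)$ for all $\alpha\in\mathrm{Inv}_{norm}(I^{n,1},A)$, all $K$, $\varphi\in\mathrm{Pf}_1(K)$ and $q\in I^{n-1}(K)$. *)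

(* Defs.v *)
From HB Require Import structures.
From mathcomp Require Import all_boot all_order all_algebra generic_quotient.
From mathcomp Require Import ring boolp mxtens.

Set Implicit Arguments.
Unset Strict Implicit.
Unset Printing Implicit Defensive.
Import GRing.Theory.
Local Open Scope ring_scope.
Local Open Scope quotient_scope.

Section Forms.
Variable F : fieldType.

(* In characteristic <> 2, a nondegenerate quadratic form x |-> x M x^T on F^n
   is determined by its symmetric invertible Gram matrix M. *)
Record qform := QForm {
  qdim : nat;
  gram : 'M[F]_qdim;
  gram_sym : gram^T = gram;
  gram_unit : gram \in unitmx }.

HB.instance Definition _ := gen_eqMixin qform.
HB.instance Definition _ := gen_choiceMixin qform.

(* An isometry between forms of a priori different dimensions: a matrix P
   with a two-sided inverse Q that transports one Gram matrix to the other. *)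
Definition isometric (p q : qform) : Prop :=
  exists (P : 'M[F]_(qdim p, qdim q)) (Q : 'M[F]_(qdim q, qdim p)),
    [/\ P *m Q = 1%:M, Q *m P = 1%:M & P *m gram q *m P^T = gram p].

Lemma isometric_refl p : isometric p p.
Proof. by exists 1%:M, 1%:M; rewrite trmx1 !mulmx1 mul1mx. Qed.

Lemma isometric_sym p q : isometric p q -> isometric q p.
Proof.
move=> [P [Q [PQ QP E]]]; exists Q, P; split=> //.
by rewrite -E !mulmxA QP mul1mx -mulmxA -trmx_mul QP trmx1 mulmx1.
Qed.

Lemma isometric_trans q p r : isometric p q -> isometric q r -> isometric p r.
Proof.
move=> [P [Q [PQ QP E]]] [P' [Q' [PQ' QP' E']]]; exists (P *m P'), (Q' *m Q).
split; first by rewrite mulmxA -(mulmxA P) PQ' mulmx1.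
  by rewrite mulmxA -(mulmxA Q') QP mulmx1.
by rewrite trmx_mul -E -E' !mulmxA.
Qed.

Lemma isometric_reindex p q (f : 'I_(qdim p) -> 'I_(qdim q)) g :
    cancel f g -> cancel g f ->
    (forall i j, gram p i j = gram q (f i) (f j)) ->
  isometric p q.
Proof.
move=> fK gK E.
have rowsub1 m n (h : 'I_m -> 'I_n) r (A : 'M[F]_(n, r)) :
  rowsub h 1%:M *m A = rowsub h A by rewrite mul_rowsub_mx mul1mx.
exists (rowsub f 1%:M), (rowsub g 1%:M); split.
- by rewrite rowsub1; apply/matrixP => i j; rewrite !mxE fK.
- by rewrite rowsub1; apply/matrixP => i j; rewrite !mxE gK.
rewrite -[LHS]trmxK trmx_mul trmxK rowsub1 rowsub1.
by apply/matrixP => i j; rewrite !mxE E.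
Qed.

Lemma qsum_sym (p q : qform) :
  (block_mx (gram p) 0 0 (gram q))^T = block_mx (gram p) 0 0 (gram q).
Proof. by rewrite tr_block_mx !trmx0 !gram_sym. Qed.

Lemma qsum_unit (p q : qform) :
  block_mx (gram p) 0 0 (gram q) \in unitmx.
Proof.
by rewrite unitmxE det_ublock unitrM -!unitmxE !gram_unit.
Qed.

Definition qsum p q := QForm (qsum_sym p q) (qsum_unit p q).

Lemma qprod_sym (p q : qform) :
  (tensmx (gram p) (gram q))^T = tensmx (gram p) (gram q).
Proof. by rewrite trmx_tens !gram_sym. Qed.

Lemma qprod_unit (p q : qform) : tensmx (gram p) (gram q) \in unitmx.
Proof.
suff: tensmx (invmx (gram p)) (invmx (gram q)) *m tensmx (gram p) (gram q)
      = 1%:M by case/mulmx1_unit.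
rewrite tensmx_mul !mulVmx ?gram_unit //; apply/matrixP => i j.
case: (mxtens_indexP i) => i0 i1; case: (mxtens_indexP j) => j0 j1.
by rewrite tensmxE !mxE (can_eq (@mxtens_indexK _ _)) xpair_eqE -natrM mulnb.
Qed.

Definition qprod p q := QForm (qprod_sym p q) (qprod_unit p q).

Definition qzero := QForm (trmx1 F 0) (unitmx1 F 0).
Definition qone := QForm (trmx1 F 1) (unitmx1 F 1).

Lemma qdiag_unit (a : {a : F | a != 0}) : (val a)%:M \in @unitmx F 1.
Proof. by rewrite unitmxE det_scalar expr1 unitfE (valP a). Qed.

Definition qdiag a := QForm (tr_scalar_mx 1 (val a)) (qdiag_unit a).

(* To compare sums and products of forms without casts on their dimensions,
   Gram matrices are transported to bilinear tables on arbitrary index types. *)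
Definition model (p : qform) (T : Type) (b : T -> T -> F) : Prop :=
  exists2 u : 'I_(qdim p) -> T,
    bijective u & forall i j, gram p i j = b (u i) (u j).

Lemma model_gram p : model p (gram p).
Proof. by exists id => //; exists id. Qed.

Lemma model_isometric p q T T' b b' (h : T -> T') : model p b -> model q b' ->
  bijective h -> (forall x y, b x y = b' (h x) (h y)) -> isometric p q.
Proof.
move=> [u [u' uK u'K] Eu] [v [v' vK v'K] Ev] [h' hK h'K] E.
apply: (@isometric_reindex p q (v' \o h \o u) (u' \o h' \o v)).
- by move=> i /=; rewrite v'K hK uK.
- by move=> i /=; rewrite u'K h'K vK.
by move=> i j; rewrite Eu E Ev /= !v'K.
Qed.

Definition sum_rel T T' (b : T -> T -> F) (b' : T' -> T' -> F) (x y : T + T') :=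
  match x, y with
  | inl x, inl y => b x y | inr x, inr y => b' x y | _, _ => 0
  end.

Definition prod_rel T T' (b : T -> T -> F) (b' : T' -> T' -> F) (x y : T * T') :=
  b x.1 y.1 * b' x.2 y.2.

Lemma model_sum p q T T' b b' :
  @model p T b -> @model q T' b' -> model (qsum p q) (sum_rel b b').
Proof.
move=> [u [u' uK u'K] Eu] [v [v' vK v'K] Ev].
pose w (i : 'I_(qdim p) + 'I_(qdim q)) : T + T' :=
  match i with inl i => inl (u i) | inr i => inr (v i) end.
pose w' (i : T + T') : 'I_(qdim p) + 'I_(qdim q) :=
  match i with inl i => inl (u' i) | inr i => inr (v' i) end.
exists (w \o @split _ _); first exists (@unsplit _ _ \o w').
- by move=> i /=; rewrite -[RHS]splitK; congr unsplit; case: split => j /=;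
    rewrite ?uK ?vK.
- by move=> i /=; rewrite unsplitK; case: i => j /=; rewrite ?u'K ?v'K.
move=> i j /=; rewrite -[in LHS](splitK i) -[in LHS](splitK j).
by case: (split i) => i'; case: (split j) => j' /=;
  rewrite ?block_mxEul ?block_mxEur ?block_mxEdl ?block_mxEdr ?mxE.
Qed.

Lemma model_prod p q T T' b b' :
  @model p T b -> @model q T' b' -> model (qprod p q) (prod_rel b b').
Proof.
move=> [u [u' uK u'K] Eu] [v [v' vK v'K] Ev].
exists (fun i => (u (mxtens_unindex i).1, v (mxtens_unindex i).2)).
  exists (fun x => mxtens_index (u' x.1, v' x.2)) => [i|[x y]].
    rewrite [X in (X, _)]uK [X in (_, X)]vK.
    by have := mxtens_unindexK i; case: (mxtens_unindex i).
  by rewrite mxtens_indexK [u _]u'K [v _]v'K.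
by move=> i j; rewrite mxE Eu Ev.
Qed.


Definition isom_rel : rel qform := [rel p q | `[< isometric p q >]].

Lemma isom_rel_equiv : equiv_class_of isom_rel.
Proof.
split=> [p|p q|q p r] /=; first exact/asboolT/isometric_refl.
  by apply/asboolP/asboolP; apply: isometric_sym.
by move=> /asboolP pq /asboolP qr; apply/asboolT/(isometric_trans pq qr).
Qed.

Canonical isom_equiv := EquivRelPack isom_rel_equiv.

(* The commutative semiring of isometry classes, with orthogonal sum and
   tensor product. *)
Definition isoclass := {eq_quot isom_equiv}.
HB.instance Definition _ := Choice.on isoclass.
HB.instance Definition _ : EqQuotient _ isom_equiv isoclass :=
  EqQuotient.on isoclass.

Definition qclass (p : qform) : isoclass := \pi p.

Lemma qclassP p q : qclass p = qclass q <-> isometric p q.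
Proof. by split=> [/eqmodP /asboolP|pq]; last exact/eqmodP/asboolP. Qed.

Lemma qclass_ind (P : isoclass -> Prop) : (forall p, P (qclass p)) -> forall x, P x.
Proof. by move=> Pp; elim/quotW. Qed.

Lemma qclass_repr (x : isoclass) : qclass (repr x) = x.
Proof. exact: reprK. Qed.

Definition isoclass_add (x y : isoclass) := qclass (qsum (repr x) (repr y)).
Definition isoclass_mul (x y : isoclass) := qclass (qprod (repr x) (repr y)).

Lemma qsum_isom p p' q q' :
  isometric p p' -> isometric q q' -> isometric (qsum p q) (qsum p' q').
Proof.
move=> [P [P' [PP' P'P EP]]] [Q [Q' [QQ' Q'Q EQ]]].
exists (block_mx P 0 0 Q), (block_mx P' 0 0 Q').
rewrite !tr_block_mx !trmx0 !mulmx_block !(mul0mx, mulmx0, addr0, add0r).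
by rewrite PP' P'P QQ' Q'Q EP EQ -!scalar_mx_block.
Qed.

Lemma tens11 m n : tensmx (1%:M : 'M[F]_m) (1%:M : 'M[F]_n) = 1%:M.
Proof.
apply/matrixP => i j.
case: (mxtens_indexP i) => i0 i1; case: (mxtens_indexP j) => j0 j1.
by rewrite tensmxE !mxE (can_eq (@mxtens_indexK _ _)) xpair_eqE -natrM mulnb.
Qed.

Lemma qprod_isom p p' q q' :
  isometric p p' -> isometric q q' -> isometric (qprod p q) (qprod p' q').
Proof.
move=> [P [P' [PP' P'P EP]]] [Q [Q' [QQ' Q'Q EQ]]].
exists (tensmx P Q), (tensmx P' Q').
by rewrite trmx_tens !tensmx_mul PP' P'P QQ' Q'Q EP EQ !tens11.
Qed.

Lemma qclassD p q : isoclass_add (qclass p) (qclass q) = qclass (qsum p q).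
Proof. by apply/qclassP/qsum_isom; apply/qclassP/qclass_repr. Qed.

Lemma qclassM p q : isoclass_mul (qclass p) (qclass q) = qclass (qprod p q).
Proof. by apply/qclassP/qprod_isom; apply/qclassP/qclass_repr. Qed.

Let sE := (qclassD, qclassM).
Let mg := model_gram.
Let ms := model_sum.
Let mp := model_prod.

Lemma isoclass_addA : associative isoclass_add.
Proof.
elim/qclass_ind=> p; elim/qclass_ind=> q; elim/qclass_ind=> r; rewrite !sE.
apply/qclassP; apply: (model_isometric (ms (mg p) (ms (mg q) (mg r)))
  (ms (ms (mg p) (mg q)) (mg r))
  (h := fun x => match x with inl a => inl (inl a) | inr (inl a) => inl (inr a)
                 | inr (inr a) => inr a end)).
  by exists (fun x => match x with inl (inl a) => inl a
     | inl (inr a) => inr (inl a) | inr a => inr (inr a) end) => [[|[]]|[[]|]].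
by move=> [?|[?|?]] [?|[?|?]].
Qed.

Lemma isoclass_addC : commutative isoclass_add.
Proof.
elim/qclass_ind=> p; elim/qclass_ind=> q; rewrite !sE.
apply/qclassP; apply: (model_isometric (ms (mg p) (mg q)) (ms (mg q) (mg p))
  (h := fun x => match x with inl a => inr a | inr a => inl a end)).
  by exists (fun x => match x with inl a => inr a | inr a => inl a end) => [[]|[]].
by move=> [?|?] [?|?].
Qed.

Lemma isoclass_add0 : left_id (qclass qzero) isoclass_add.
Proof.
elim/qclass_ind=> p; rewrite !sE; apply/qclassP/isometric_sym.
apply: (model_isometric (mg p) (ms (mg qzero) (mg p)) (h := inr)) => //.
by exists (fun x : 'I_0 + 'I_(qdim p) => match x with
  | inl (Ordinal _ a) => match notF a with end | inr a => a end) => // -[[]|].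
Qed.

HB.instance Definition _ := GRing.isNmodule.Build isoclass
  isoclass_addA isoclass_addC isoclass_add0.

Lemma isoclass_mulA : associative isoclass_mul.
Proof.
elim/qclass_ind=> p; elim/qclass_ind=> q; elim/qclass_ind=> r; rewrite !sE.
apply/qclassP; apply: (model_isometric (mp (mg p) (mp (mg q) (mg r)))
  (mp (mp (mg p) (mg q)) (mg r)) (h := fun x => (x.1, x.2.1, x.2.2))).
  by exists (fun x => (x.1.1, (x.1.2, x.2))) => [[? []]|[[]]].
by move=> x y; apply: mulrA.
Qed.

Lemma isoclass_mulC : commutative isoclass_mul.
Proof.
elim/qclass_ind=> p; elim/qclass_ind=> q; rewrite !sE.
apply/qclassP; apply: (model_isometric (mp (mg p) (mg q)) (mp (mg q) (mg p))
  (h := fun x => (x.2, x.1))).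
  by exists (fun x => (x.2, x.1)) => [[]|[]].
by move=> x y; apply: mulrC.
Qed.

Lemma isoclass_mul1 : left_id (qclass qone) isoclass_mul.
Proof.
elim/qclass_ind=> p; rewrite !sE; apply/qclassP/isometric_sym.
apply: (model_isometric (mg p) (mp (mg qone) (mg p)) (h := fun x => (ord0, x))).
  by exists snd => // -[i x]; rewrite (ord1 i).
by move=> x y; rewrite /prod_rel mxE mul1r.
Qed.

Lemma isoclass_mulDl : left_distributive isoclass_mul isoclass_add.
Proof.
elim/qclass_ind=> p; elim/qclass_ind=> q; elim/qclass_ind=> r; rewrite !sE.
apply/qclassP; apply: (model_isometric (mp (ms (mg p) (mg q)) (mg r))
  (ms (mp (mg p) (mg r)) (mp (mg q) (mg r)))
  (h := fun x => match x with
     (inl a, b) => inl (a, b) | (inr a, b) => inr (a, b) end)).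
  by exists (fun x => match x with
     inl (a, b) => (inl a, b) | inr (a, b) => (inr a, b) end)
    => [[[?|?] ?]|[[? ?]|[? ?]]].
by move=> [[?|?] ?] [[?|?] ?]; rewrite /prod_rel //= mul0r.
Qed.

Lemma isoclass_mul0 : left_zero (qclass qzero) isoclass_mul.
Proof.
elim/qclass_ind=> p; rewrite !sE; apply/qclassP.
by apply: (@isometric_reindex (qprod qzero p) qzero id id) => // -[].
Qed.

HB.instance Definition _ := GRing.Nmodule_isComPzSemiRing.Build isoclass
  isoclass_mulA isoclass_mulC isoclass_mul1 isoclass_mulDl isoclass_mul0.

Lemma qdim_isom p q : isometric p q -> qdim p = qdim q.
Proof.
move=> [P [Q [PQ QP _]]]; apply/eqP; rewrite eqn_leq.
by rewrite (mulmx1_min PQ) (mulmx1_min QP).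
Qed.

Definition isoclass_dim (x : isoclass) : int := (qdim (repr x))%:Z.

Lemma isoclass_dimE p : isoclass_dim (qclass p) = qdim p.
Proof. by congr Posz; apply/qdim_isom/qclassP/qclass_repr. Qed.

Lemma isoclass_dimD : nmod_morphism isoclass_dim.
Proof.
split; first exact: (isoclass_dimE qzero).
elim/qclass_ind=> p; elim/qclass_ind=> q.
by rewrite [_ + _]qclassD !isoclass_dimE PoszD.
Qed.
HB.instance Definition _ :=
  GRing.isNmodMorphism.Build isoclass int isoclass_dim isoclass_dimD.
Lemma isoclass_dimM : monoid_morphism isoclass_dim.
Proof.
split; first exact: (isoclass_dimE qone).
elim/qclass_ind=> p; elim/qclass_ind=> q.
by rewrite [_ * _]qclassM !isoclass_dimE PoszM.
Qed.
HB.instance Definition _ :=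
  GRing.isMonoidMorphism.Build isoclass int isoclass_dim isoclass_dimM.
End Forms.

Section BaseChange.
Variables (K L : fieldType) (s : {rmorphism K -> L}).

Lemma qmap_sym (p : qform K) : (map_mx s (gram p))^T = map_mx s (gram p).
Proof. by rewrite map_trmx gram_sym. Qed.

Lemma qmap_unit (p : qform K) : map_mx s (gram p) \in unitmx.
Proof. by rewrite map_unitmx gram_unit. Qed.

Definition qmap (p : qform K) := QForm (qmap_sym p) (qmap_unit p).

Lemma qmap_isom p q : isometric p q -> isometric (qmap p) (qmap q).
Proof.
move=> [P [Q [PQ QP E]]]; exists (map_mx s P), (map_mx s Q).
by rewrite /= map_trmx -!map_mxM PQ QP !map_mx1 E.
Qed.

Definition isoclass_map (x : isoclass K) : isoclass L := qclass (qmap (repr x)).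

Lemma isoclass_mapE p : isoclass_map (qclass p) = qclass (qmap p).
Proof. by apply/qclassP/qmap_isom/qclassP/qclass_repr. Qed.

Lemma isoclass_mapD : nmod_morphism isoclass_map.
Proof.
split; first by rewrite [0]/(qclass _) isoclass_mapE; apply/qclassP;
  apply: (@isometric_reindex _ (qmap (qzero K)) (qzero L) id id) => // -[].
elim/qclass_ind=> p; elim/qclass_ind=> q.
rewrite [_ + _]qclassD !isoclass_mapE [_ + _]qclassD; apply/qclassP.
apply: (@isometric_reindex _ (qmap (qsum p q)) (qsum (qmap p) (qmap q)) id id)
  => // i j.
by rewrite /= map_block_mx !map_mx0.
Qed.
HB.instance Definition _ :=
  GRing.isNmodMorphism.Build _ _ isoclass_map isoclass_mapD.

Lemma isoclass_mapM : monoid_morphism isoclass_map.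
Proof.
split; first by rewrite [1]/(qclass _) isoclass_mapE; apply/qclassP;
  apply: (@isometric_reindex _ (qmap (qone K)) (qone L) id id) => // i j;
  rewrite /= map_mx1.
elim/qclass_ind=> p; elim/qclass_ind=> q.
rewrite [_ * _]qclassM !isoclass_mapE [_ * _]qclassM; apply/qclassP.
apply: (@isometric_reindex _ (qmap (qprod p q)) (qprod (qmap p) (qmap q)) id id)
  => // i j.
by rewrite /= map_mxT.
Qed.
HB.instance Definition _ :=
  GRing.isMonoidMorphism.Build _ _ isoclass_map isoclass_mapM.

End BaseChange.

(* The Grothendieck ring of a commutative semiring. *)
Section Grothendieck.
Variable S : comPzSemiRingType.

Definition groth_rel : rel (S * S) :=
  [rel x y | `[< exists z, x.1 + y.2 + z = y.1 + x.2 + z >]].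

Lemma groth_rel_equiv : equiv_class_of groth_rel.
Proof.
split=> [x|x y|y x z] /=; first by apply/asboolT; exists 0.
  by apply/asboolP/asboolP => -[z E]; exists z.
move=> /asboolP[t E] /asboolP[t' E']; apply/asboolT; exists (y.1 + y.2 + t + t').
have -> : x.1 + z.2 + (y.1 + y.2 + t + t')
  = (x.1 + y.2 + t) + (y.1 + z.2 + t') by ring.
by rewrite E E'; ring.
Qed.

Canonical groth_equiv := EquivRelPack groth_rel_equiv.

Definition groth := {eq_quot groth_equiv}.
HB.instance Definition _ := Choice.on groth.
HB.instance Definition _ : EqQuotient _ groth_equiv groth :=
  EqQuotient.on groth.

Definition gdiff (a b : S) : groth := \pi_groth (a, b).

Lemma gdiffP a b c d :
  gdiff a b = gdiff c d <-> exists z, a + d + z = c + b + z.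
Proof. by split=> [/eqmodP /asboolP|E]; last exact/eqmodP/asboolP. Qed.

Lemma groth_ind (P : groth -> Prop) :
  (forall a b, P (gdiff a b)) -> forall x, P x.
Proof. by move=> Pab; elim/quotW => -[]. Qed.

Lemma gdiff_repr (x : groth) : gdiff (repr x).1 (repr x).2 = x.
Proof. by rewrite /gdiff -surjective_pairing reprK. Qed.

Definition groth_add (x y : groth) :=
  gdiff ((repr x).1 + (repr y).1) ((repr x).2 + (repr y).2).
Definition groth_opp (x : groth) := gdiff (repr x).2 (repr x).1.
Definition groth_mul (x y : groth) :=
  gdiff ((repr x).1 * (repr y).1 + (repr x).2 * (repr y).2)
        ((repr x).1 * (repr y).2 + (repr x).2 * (repr y).1).

Lemma gdiffD a b c d :
  groth_add (gdiff a b) (gdiff c d) = gdiff (a + c) (b + d).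
Proof.
have /gdiffP[t E] := gdiff_repr (gdiff a b).
have /gdiffP[u E'] := gdiff_repr (gdiff c d).
apply/gdiffP; exists (t + u); move: E E'.
move: (repr _).1 (repr _).2 => x y; move: (repr _).1 (repr _).2 => z w E E'.
transitivity ((x + b + t) + (z + d + u)); first by ring.
by rewrite E E'; ring.
Qed.

Lemma gdiffN a b : groth_opp (gdiff a b) = gdiff b a.
Proof.
have /gdiffP[t E] := gdiff_repr (gdiff a b).
apply/gdiffP; exists t; move: E.
move: (repr _).1 (repr _).2 => x y E.
by rewrite [y + a]addrC -E addrC [b + x]addrC addrC.
Qed.

Lemma gdiffM a b c d :
  groth_mul (gdiff a b) (gdiff c d) = gdiff (a * c + b * d) (a * d + b * c).
Proof.
have /gdiffP[t E] := gdiff_repr (gdiff a b).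
have /gdiffP[u E'] := gdiff_repr (gdiff c d).
move: E E'; rewrite /groth_mul.
move: (repr (gdiff a b)).1 (repr (gdiff a b)).2 => x y.
move: (repr (gdiff c d)).1 (repr (gdiff c d)).2 => z w E E'.
transitivity (gdiff (a * z + b * w) (a * w + b * z)).
  apply/gdiffP; exists (t * z + t * w).
  have Ez : (x + b + t) * z = (a + y + t) * z by rewrite E.
  have Ew : (x + b + t) * w = (a + y + t) * w by rewrite E.
  transitivity ((x + b + t) * z + (a + y + t) * w); first by ring.
  by rewrite Ez -Ew; ring.
apply/gdiffP; exists (a * u + b * u).
transitivity (a * (z + d + u) + b * (c + w + u)); first by ring.
by rewrite [in X in X + _]E' -[in X in _ + X]E'; ring.
Qed.

Let gE := (gdiffD, gdiffN, gdiffM).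

Lemma groth_addA : associative groth_add.
Proof.
elim/groth_ind=> a b; elim/groth_ind=> c d; elim/groth_ind=> e f.
by rewrite !gE; congr gdiff; rewrite addrA.
Qed.

Lemma groth_addC : commutative groth_add.
Proof.
elim/groth_ind=> a b; elim/groth_ind=> c d.
by rewrite !gE; congr gdiff; rewrite addrC.
Qed.

Lemma groth_add0 : left_id (gdiff 0 0) groth_add.
Proof. by elim/groth_ind=> a b; rewrite !gE !add0r. Qed.

Lemma groth_addN : left_inverse (gdiff 0 0) groth_opp groth_add.
Proof.
by elim/groth_ind=> a b; rewrite !gE; apply/gdiffP; exists 0; ring.
Qed.

HB.instance Definition _ := GRing.isZmodule.Build groth
  groth_addA groth_addC groth_add0 groth_addN.

Lemma groth_mulA : associative groth_mul.
Proof.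
elim/groth_ind=> a b; elim/groth_ind=> c d; elim/groth_ind=> e f.
by rewrite !gE; congr gdiff; ring.
Qed.

Lemma groth_mulC : commutative groth_mul.
Proof.
elim/groth_ind=> a b; elim/groth_ind=> c d.
by rewrite !gE; congr gdiff; ring.
Qed.

Lemma groth_mul1 : left_id (gdiff 1 0) groth_mul.
Proof. by elim/groth_ind=> a b; rewrite !gE; congr gdiff; ring. Qed.

Lemma groth_mulDl : left_distributive groth_mul groth_add.
Proof.
elim/groth_ind=> a b; elim/groth_ind=> c d; elim/groth_ind=> e f.
by rewrite !gE; congr gdiff; ring.
Qed.

HB.instance Definition _ := GRing.Zmodule_isComPzRing.Build groth
  groth_mulA groth_mulC groth_mul1 groth_mulDl.

Lemma gdiff_opp a b : - gdiff a b = gdiff b a. Proof. exact: gdiffN. Qed.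
Lemma gdiff_add a b c d : gdiff a b + gdiff c d = gdiff (a + c) (b + d).
Proof. exact: gdiffD. Qed.
Lemma gdiff_mul a b c d :
  gdiff a b * gdiff c d = gdiff (a * c + b * d) (a * d + b * c).
Proof. exact: gdiffM. Qed.

Definition to_groth (a : S) := gdiff a 0.

Lemma to_groth_is_nmod_morphism : nmod_morphism to_groth.
Proof. by split=> // a b; rewrite gdiff_add addr0. Qed.
HB.instance Definition _ :=
  GRing.isNmodMorphism.Build S groth to_groth to_groth_is_nmod_morphism.

Lemma to_groth_is_monoid_morphism : monoid_morphism to_groth.
Proof. by split=> // a b; rewrite gdiff_mul; congr gdiff; ring. Qed.
HB.instance Definition _ :=
  GRing.isMonoidMorphism.Build S groth to_groth to_groth_is_monoid_morphism.

Lemma gdiffE a b : gdiff a b = to_groth a - to_groth b.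
Proof. by rewrite gdiff_opp gdiff_add addr0 add0r. Qed.

Variables (R : comPzRingType) (f : {rmorphism S -> R}).

Definition groth_lift (x : groth) : R := f (repr x).1 - f (repr x).2.

Lemma groth_liftE a b : groth_lift (gdiff a b) = f a - f b.
Proof.
have /gdiffP[t] := gdiff_repr (gdiff a b); rewrite /groth_lift.
move: (repr _).1 (repr _).2 => x y /(congr1 f); rewrite !rmorphD => /addIr E.
by apply/eqP; rewrite subr_eq addrAC eq_sym subr_eq eq_sym E.
Qed.

Lemma groth_lift_is_zmod_morphism : zmod_morphism groth_lift.
Proof.
elim/groth_ind=> a b; elim/groth_ind=> c d.
by rewrite gdiff_opp gdiff_add !groth_liftE !rmorphD; ring.
Qed.
HB.instance Definition _ :=
  GRing.isZmodMorphism.Build groth R groth_lift groth_lift_is_zmod_morphism.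

Lemma groth_lift_is_monoid_morphism : monoid_morphism groth_lift.
Proof.
split; first by rewrite groth_liftE rmorph1 rmorph0 subr0.
elim/groth_ind=> a b; elim/groth_ind=> c d.
by rewrite gdiff_mul !groth_liftE !rmorphD !rmorphM; ring.
Qed.
HB.instance Definition _ :=
  GRing.isMonoidMorphism.Build groth R groth_lift groth_lift_is_monoid_morphism.

Lemma groth_lift_to x : groth_lift (to_groth x) = f x.
Proof. by rewrite groth_liftE rmorph0 subr0. Qed.

End Grothendieck.

(* The Grothendieck-Witt ring. *)
Notation GW F := (groth (isoclass F)).

(* The virtual dimension; its kernel is the ideal \hat I(F). *)
Definition vdim (F : fieldType) : {rmorphism GW F -> int} :=
  groth_lift (@isoclass_dim F).

Definition GW_map (K L : fieldType) (s : {rmorphism K -> L}) :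
  {rmorphism GW K -> GW L} := groth_lift (@to_groth _ \o isoclass_map s).

Lemma GW_mapE (K L : fieldType) (s : {rmorphism K -> L}) p q :
  GW_map s (gdiff (qclass p) (qclass q)) =
  gdiff (qclass (qmap s p)) (qclass (qmap s q)).
Proof. by rewrite [LHS]groth_liftE /= !isoclass_mapE -gdiffE. Qed.

Lemma GW_ind (F : fieldType) (P : GW F -> Prop) :
  (forall p q, P (gdiff (qclass p) (qclass q))) -> forall x, P x.
Proof.
by move=> H; elim/groth_ind; elim/qclass_ind=> p; elim/qclass_ind=> q.
Qed.

Lemma vdim_map (K L : fieldType) (s : {rmorphism K -> L}) x :
  vdim L (GW_map s x) = vdim K x.
Proof.
elim/GW_ind: x => p q.
by rewrite GW_mapE [LHS]groth_liftE [RHS]groth_liftE /= !isoclass_dimE.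
Qed.

Lemma GW_map_id (K : fieldType) (s : {rmorphism K -> K}) :
  s =1 id -> GW_map s =1 id.
Proof.
move=> s1; elim/GW_ind=> p q; rewrite GW_mapE.
have E r : qclass (qmap s r) = qclass r.
  apply/qclassP/(@isometric_reindex _ (qmap s r) r id id)
  => // i j.
  by rewrite mxE s1.
by rewrite !E.
Qed.

Lemma GW_map_comp (K L M : fieldType) (s : {rmorphism K -> L})
    (t : {rmorphism L -> M}) (u : {rmorphism K -> M}) :
  u =1 t \o s -> GW_map u =1 GW_map t \o GW_map s.
Proof.
move=> uE; elim/GW_ind=> p q.
transitivity (GW_map t (GW_map s (gdiff (qclass p) (qclass q)))) => //.
rewrite !GW_mapE.
have E r : qclass (qmap u r) = qclass (qmap t (qmap s r)).
  apply/qclassP/(@isometric_reindex _ (qmap u r) (qmap t (qmap s r)) id id)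
  => // i j.
  by rewrite !mxE uE.
by rewrite !E.
Qed.

Definition nonzero (F : fieldType) := {a : F | a != 0}.

Definition nonzero1 (F : fieldType) : nonzero F := exist _ 1 (oner_neq0 F).

Section NonzeroMap.
Variables (K L : fieldType) (s : {rmorphism K -> L}).

Lemma nonzero_map_subproof (a : nonzero K) : s (val a) != 0.
Proof. by rewrite fmorph_eq0 (valP a). Qed.

Definition nonzero_map (a : nonzero K) : nonzero L :=
  exist _ (s (val a)) (nonzero_map_subproof a).
End NonzeroMap.

Section Pfister.
Variable F : fieldType.
Implicit Types (x y : GW F) (a : nonzero F).

(* <a>, <<a>> = <1> - <a>, and <<a_1, ..., a_n>>, all in GW(F). *)
Definition form1 a : GW F := to_groth (qclass (qdiag a)).

Definition pf1 a : GW F := form1 (nonzero1 F) - form1 a.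

Definition pfister n (a : n.-tuple (nonzero F)) : GW F := \prod_(c <- a) pf1 c.

Definition is_pfister n x := exists a : n.-tuple (nonzero F), x = pfister a.

(* The n-th power of the ideal \hat I(F): finite sums of products x * y with
   x in \hat I(F) and y in \hat I^(n-1)(F). For n >= 1 the projection from
   GW(F) to W(F) maps it isomorphically onto I^n(F), and the two are
   identified: it is what I^n(F) means below. *)
Fixpoint fund_pow n : GW F -> Prop :=
  if n isn't m.+1 then fun=> True else fun x =>
  exists2 s : seq (GW F * GW F),
    (forall p, p \in s -> vdim F p.1 = 0 /\ fund_pow m p.2) &
    x = \sum_(p <- s) p.1 * p.2.

(* I^{n,r}(F), for 0 <= r < n. *)
Definition pfister_mult n r x :=
  exists (a : r.-tuple (nonzero F)) (q : GW F),
    fund_pow (n - r) q /\ x = pfister a * q.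

Lemma form1_1 : form1 (nonzero1 F) = 1.
Proof.
congr to_groth; apply/qclassP.
exact: (@isometric_reindex _ (qdiag (nonzero1 F)) (qone F) id id).
Qed.

Lemma pf1_1 : pf1 (nonzero1 F) = 0.
Proof. exact: subrr. Qed.

Lemma vdim_form1 a : vdim F (form1 a) = 1.
Proof. by etransitivity; [exact: groth_lift_to | exact: isoclass_dimE]. Qed.

Lemma vdim_pf1 a : vdim F (pf1 a) = 0.
Proof. by rewrite rmorphB !vdim_form1 subrr. Qed.

Lemma fund_pow0 n : fund_pow n 0.
Proof. by case: n => //= n; exists [::] => //; rewrite big_nil. Qed.

Lemma fund_pow1 x : fund_pow 1 x <-> vdim F x = 0.
Proof.
split=> [[s sP ->]|x0].
  rewrite rmorph_sum /= big_seq big1 // => p ps.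
  by rewrite rmorphM (sP p ps).1 mul0r.
exists [:: (x, 1)]; last by rewrite big_seq1 mulr1.
by move=> p; rewrite inE => /eqP ->.
Qed.

Lemma fund_pow_pf1 a : fund_pow 1 (pf1 a).
Proof. exact/fund_pow1/vdim_pf1. Qed.

Lemma pfister1 a : pfister [tuple a] = pf1 a.
Proof. exact: big_seq1. Qed.

Lemma pfister_mult0 n r : pfister_mult n r 0.
Proof.
exists [tuple of nseq r (nonzero1 F)], 0; rewrite mulr0.
by split=> //; apply: fund_pow0.
Qed.

End Pfister.

Section PfisterMap.
Variables (K L : fieldType) (s : {rmorphism K -> L}).

Lemma GW_map_form1 a : GW_map s (form1 a) = form1 (nonzero_map s a).
Proof.
transitivity (to_groth (isoclass_map s (qclass (qdiag a)))).
  exact: groth_lift_to.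
rewrite isoclass_mapE; congr to_groth; apply/qclassP.
apply/(@isometric_reindex _ (qmap s (qdiag a)) (qdiag (nonzero_map s a)) id id)
  => // i j.
by rewrite /= map_scalar_mx.
Qed.

Lemma GW_map_pf1 a : GW_map s (pf1 a) = pf1 (nonzero_map s a).
Proof. by rewrite /pf1 !form1_1 rmorphB rmorph1 GW_map_form1. Qed.

Lemma GW_map_pfister n (a : n.-tuple _) :
  GW_map s (pfister a) = pfister [tuple of map (nonzero_map s) a].
Proof.
rewrite /pfister rmorph_prod /= big_map; apply: eq_bigr => c _; exact: GW_map_pf1.
Qed.

Lemma is_pfister_map n x : is_pfister n x -> is_pfister n (GW_map s x).
Proof.
move=> [a ->]; rewrite GW_map_pfister.
by exists [tuple of map (nonzero_map s) a].
Qed.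

Lemma fund_pow_map n x : fund_pow n x -> fund_pow n (GW_map s x).
Proof.
elim: n x => //= n IH _ [t tP ->].
exists [seq (GW_map s p.1, GW_map s p.2) | p <- t].
  by move=> _ /mapP[p /tP[p0 pI] ->] /=; rewrite vdim_map; split; last exact: IH.
by rewrite big_map rmorph_sum; apply: eq_bigr => p _; rewrite rmorphM.
Qed.

Lemma pfister_mult_map n r x : pfister_mult n r x -> pfister_mult n r (GW_map s x).
Proof.
move=> [a [q [qI ->]]]; exists [tuple of map (nonzero_map s) a], (GW_map s q).
by rewrite rmorphM GW_map_pfister; split=> //; apply: fund_pow_map.
Qed.
End PfisterMap.

(* Arbitrary (not necessarily finite or algebraic) extensions of k. *)
Record extension (k : fieldType) := Extension {
  ext_field :> fieldType;
  ext_map : {rmorphism k -> ext_field} }.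

Record ext_hom (k : fieldType) (K L : extension k) := ExtHom {
  ext_hom_fun :> {rmorphism K -> L};
  ext_homP : forall x, ext_hom_fun (ext_map K x) = ext_map L x }.

Definition trivial_ext (k : fieldType) : extension k :=
  @Extension k k (idfun : {rmorphism k -> k}).

Definition ext_init (k : fieldType) (K : extension k) :
  ext_hom (trivial_ext k) K :=
  @ExtHom k (trivial_ext k) K (ext_map K) (fun x => erefl).

(* Functor laws are stated up to pointwise equality of field morphisms: this is
   the identity and composition law together with extensionality. *)
Record setFunctor (k : fieldType) := SetFunctor {
  sf_obj :> extension k -> Type;
  sf_map : forall K L : extension k, ext_hom K L -> sf_obj K -> sf_obj L;
  sf_map_id : forall (K : extension k) (s : ext_hom K K),
    s =1 id -> sf_map s =1 id;
  sf_map_comp : forall (K L M : extension k)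
      (s : ext_hom K L) (t : ext_hom L M) (u : ext_hom K M),
    u =1 t \o s -> sf_map u =1 sf_map t \o sf_map s }.

Record pointedFunctor (k : fieldType) := PointedFunctor {
  pf_functor :> setFunctor k;
  pf_point : forall K : extension k, pf_functor K;
  pf_point_map : forall (K L : extension k) (s : ext_hom K L),
    sf_map s (pf_point K) = pf_point L }.

Record ringFunctor (k : fieldType) := RingFunctor {
  rf_obj :> extension k -> comPzRingType;
  rf_map : forall K L : extension k,
    ext_hom K L -> {rmorphism rf_obj K -> rf_obj L};
  rf_map_id : forall (K : extension k) (s : ext_hom K K),
    s =1 id -> rf_map s =1 id;
  rf_map_comp : forall (K L M : extension k)
      (s : ext_hom K L) (t : ext_hom L M) (u : ext_hom K M),
    u =1 t \o s -> rf_map u =1 rf_map t \o rf_map s }.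

(* An extension L of an extension K of k is an extension of k, so that functors
   on extensions of k restrict to extensions of K. *)
Section Restriction.
Variables (k : fieldType) (K : extension k).

Definition restr_ext (L : extension K) : extension k :=
  @Extension k L (ext_map L \o ext_map K : {rmorphism k -> L}).

Lemma restr_hom_subproof (L M : extension K) (s : ext_hom L M) x :
  s (ext_map (restr_ext L) x) = ext_map (restr_ext M) x.
Proof. exact: ext_homP. Qed.

Definition restr_hom (L M : extension K) (s : ext_hom L M) :
  ext_hom (restr_ext L) (restr_ext M) :=
  @ExtHom k (restr_ext L) (restr_ext M) s (restr_hom_subproof s).

Definition restr_init (L : extension K) : ext_hom K (restr_ext L) :=
  @ExtHom k K (restr_ext L) (ext_map L) (fun x => erefl).

Definition restr_ring (A : ringFunctor k) : ringFunctor K :=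
  @RingFunctor K (fun L => A (restr_ext L))
    (fun L M s => rf_map A (restr_hom s))
    (fun L s => @rf_map_id k A (restr_ext L) (restr_hom s))
    (fun L M N s t u =>
      @rf_map_comp k A _ _ _ (restr_hom s) (restr_hom t) (restr_hom u)).
End Restriction.

(* Natural transformations from X to (the underlying functor of) A. *)
Record Inv (k : fieldType) (X : setFunctor k) (A : ringFunctor k) := Invariant {
  inv_fun :> forall K : extension k, X K -> A K;
  inv_nat : forall (K L : extension k) (s : ext_hom K L) (x : X K),
    inv_fun (sf_map s x) = rf_map A s (inv_fun x) }.

Record InvNorm (k : fieldType) (X : pointedFunctor k) (A : ringFunctor k) :=
  NormInvariant {
    inv_norm_inv :> Inv X A;
    inv_normP : forall K : extension k, inv_norm_inv K (pf_point X K) = 0 }.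

(* The A(k)-module structure of Inv_norm(X, A) is pointwise. It is not packaged
   as an lmodType: an element of Inv_norm(X, A) is a family indexed by all
   fields, and the universe of fieldType is strictly above that of carriers of
   MathComp structures. *)
Section InvNormModule.
Variables (k : fieldType) (X : pointedFunctor k) (A : ringFunctor k).
Implicit Types (f g : InvNorm X A) (c : A (trivial_ext k)).

Lemma InvNorm_eq f g : (forall (K : extension k) (x : X K), f K x = g K x) -> f = g.
Proof.
case: f g => [[f fN] fP] [[g gN] gP] /= E.
have {}E : f = g by apply: functional_extensionality_dep => K; apply/funext => x.
subst g; have {}E : fN = gN by apply: Prop_irrelevance.
by subst gN; congr NormInvariant; apply: Prop_irrelevance.
Qed.

Lemma inv_add_nat f g (K L : extension k) (s : ext_hom K L) (x : X K) :
  f L (sf_map s x) + g L (sf_map s x) = rf_map A s (f K x + g K x).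
Proof. by rewrite !inv_nat rmorphD. Qed.

Lemma inv_add_norm f g K : f K (pf_point X K) + g K (pf_point X K) = 0.
Proof. by rewrite !inv_normP addr0. Qed.

Definition inv_norm_add f g : InvNorm X A :=
  @NormInvariant k X A (Invariant (inv_add_nat f g)) (inv_add_norm f g).

Lemma inv_scale_nat c f (K L : extension k) (s : ext_hom K L) (x : X K) :
  rf_map A (ext_init L) c * f L (sf_map s x) =
  rf_map A s (rf_map A (ext_init K) c * f K x).
Proof.
rewrite inv_nat rmorphM; congr (_ * _).
by apply: rf_map_comp => y /=; rewrite ext_homP.
Qed.

Lemma inv_scale_norm c f K :
  rf_map A (ext_init K) c * f K (pf_point X K) = 0.
Proof. by rewrite inv_normP mulr0. Qed.

Definition inv_norm_scale c f : InvNorm X A :=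
  @NormInvariant k X A (Invariant (inv_scale_nat c f)) (inv_scale_norm c f).
End InvNormModule.

Section Subfunctor.
Variable P : forall F : fieldType, GW F -> Prop.
Hypothesis P_map : forall (K L : fieldType) (s : {rmorphism K -> L}) x,
  P x -> P (GW_map s x).
Variable k : fieldType.

Definition subGW_obj (K : extension k) : Type := {x : GW K | P x}.

Definition subGW_map (K L : extension k) (s : ext_hom K L)
  (x : subGW_obj K) : subGW_obj L :=
  exist _ (GW_map s (sval x)) (P_map s (svalP x)).

Lemma subGW_eq (K : extension k) (x y : subGW_obj K) : sval x = sval y -> x = y.
Proof. by case: x y => x xP [y yP] /= E; apply: eq_exist. Qed.

Lemma subGW_map_id (K : extension k) (s : ext_hom K K) :
  s =1 id -> subGW_map s =1 id.
Proof. by move=> s1 x; apply/subGW_eq/GW_map_id. Qed.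

Lemma subGW_map_comp (K L M : extension k)
      (s : ext_hom K L) (t : ext_hom L M) (u : ext_hom K M) :
  u =1 t \o s -> subGW_map u =1 subGW_map t \o subGW_map s.
Proof. by move=> uE x; apply/subGW_eq/GW_map_comp. Qed.

Definition subGW : setFunctor k := SetFunctor subGW_map_id subGW_map_comp.

Hypothesis P0 : forall F : fieldType, P (0 : GW F).

Definition subGW0_point (K : extension k) : subGW K := exist _ 0 (P0 K).

Lemma subGW0_point_map (K L : extension k) (s : ext_hom K L) :
  sf_map s (subGW0_point K) = subGW0_point L.
Proof. by apply: subGW_eq; rewrite /= rmorph0. Qed.

Definition subGW0 : pointedFunctor k := PointedFunctor subGW0_point_map.
End Subfunctor.

(* The functors Pf_n, I^n and I^{n,r}; the last two are pointed by 0. *)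
Definition Pf (k : fieldType) n : setFunctor k :=
  subGW (fun K L s => @is_pfister_map K L s n) k.
Definition In (k : fieldType) n : pointedFunctor k :=
  subGW0 (fun K L s => @fund_pow_map K L s n) k (fun F => fund_pow0 F n).
Definition Inr (k : fieldType) n r : pointedFunctor k :=
  subGW0 (fun K L s => @pfister_mult_map K L s n r) k (fun F => pfister_mult0 F n r).

Lemma tuple1P (T : Type) (a : 1.-tuple T) : exists b, a = [tuple b].
Proof. by case/tupleP: a => b t; exists b; apply: val_inj; rewrite /= tuple0. Qed.

Section Elements.
Variables (k : fieldType) (K : extension k).

Definition pfister_elt n (a : n.-tuple (nonzero K)) : Pf k n K :=
  exist _ (pfister a) (ex_intro _ a erefl).

Definition pf1_I (a : nonzero K) : In k 1 K := exist _ (pf1 a) (fund_pow_pf1 a).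

Lemma Pf1_sub_I (x : GW K) : is_pfister 1 x -> fund_pow 1 x.
Proof.
by move=> [a ->]; have [b ->] := tuple1P a; rewrite pfister1; apply: fund_pow_pf1.
Qed.

Definition Pf1_I (phi : Pf k 1 K) : In k 1 K :=
  exist _ (sval phi) (Pf1_sub_I (svalP phi)).

Lemma Pf1_mul_subproof n (phi : Pf k 1 K) (q : In k (n - 1) K) :
  pfister_mult n 1 (sval phi * sval q).
Proof.
by case: phi q => x [a xa] [q qI]; exists a, q; split=> //=; rewrite xa.
Qed.

Definition Pf1_mul n (phi : Pf k 1 K) (q : In k (n - 1) K) : Inr k n 1 K :=
  exist _ (sval phi * sval q) (Pf1_mul_subproof phi q).
End Elements.

Record filteredFunctor (k : fieldType) := FilteredFunctor {
  ff_ring :> ringFunctor k;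
  fil : forall K : extension k, nat -> ff_ring K -> Prop;
  filT : forall (K : extension k) (x : ff_ring K), fil 0 x;
  filS : forall (K : extension k) n (x : ff_ring K), fil n.+1 x -> fil n x;
  fil0 : forall (K : extension k) n, fil n (0 : ff_ring K);
  filB : forall (K : extension k) n (x y : ff_ring K),
    fil n x -> fil n y -> fil n (x - y);
  filM : forall (K : extension k) m n (x y : ff_ring K),
    fil m x -> fil n y -> fil (m + n) (x * y);
  fil_map : forall (K L : extension k) (s : ext_hom K L) n (x : ff_ring K),
    fil n x -> fil n (rf_map ff_ring s x);
  fil_sep : forall (K : extension k) (x : ff_ring K),
    (forall n, fil n x) -> x = 0 }.

(* A together with the natural map f_1 : I -> A^1. *)
Record symbolFunctor (k : fieldType) := SymbolFunctor {
  sym_fil :> filteredFunctor k;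
  f1 : forall K : extension k, In k 1 K -> sym_fil K;
  f1_fil : forall (K : extension k) (x : In k 1 K), fil 1 (f1 x);
  f1_nat : forall (K L : extension k) (s : ext_hom K L) (x : In k 1 K),
    f1 (sf_map s x) = rf_map sym_fil s (f1 x) }.

(* {a_1, ..., a_n} = f_1(<<a_1>>) ... f_1(<<a_n>>). *)
Definition symb (k : fieldType) (A : symbolFunctor k) (K : extension k)
    n (a : n.-tuple (nonzero K)) : A K :=
  \prod_(c <- a) f1 A (pf1_I c).

(* coef_pfister: <<a_1, ..., a_n>> |-> {a_1, ..., a_n} is well defined (->) and
   injective (<-) on Pf_n(K).
   coef_fn: on I^n(K) it extends to an additive map f_n, with values in A^n(K).
   coef_fil: x lies in A^d(K) as soon as {a} x_L lies in A^(d+1)(L) for all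
   extensions L/K and all a in L^*.
   coef_inv: every invariant over K of Pf_n has the form x + y f_n for unique
   x, y in A(K). *)
Record coefficients (k : fieldType) := Coefficients {
  coef_sym :> symbolFunctor k;
  coef_pfister : forall (K : extension k) n (a b : n.-tuple (nonzero K)),
    pfister a = pfister b <-> symb coef_sym a = symb coef_sym b;
  coef_fn : forall (K : extension k) n, (1 <= n)%N ->
    exists f : In k n K -> coef_sym K,
      [/\ forall x y z : In k n K,
            sval z = sval x + sval y -> f z = f x + f y,
          forall x : In k n K, fil n (f x) &
          forall (x : In k n K) (a : n.-tuple (nonzero K)),
            sval x = pfister a -> f x = symb coef_sym a];
  coef_fil : forall (K : extension k) d (x : coef_sym K),
    (forall (L : extension k) (s : ext_hom K L) (a : nonzero L),
      fil d.+1 (f1 coef_sym (pf1_I a) * rf_map coef_sym s x)) ->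
    fil d x;
  coef_inv : forall (K : extension k) n, (1 <= n)%N ->
    forall alpha : Inv (Pf K n) (restr_ring K coef_sym),
    exists! xy : coef_sym K * coef_sym K,
      forall (L : extension K) (a : n.-tuple (nonzero L)),
        alpha L (pfister_elt a) =
          rf_map coef_sym (restr_init L) xy.1 +
          rf_map coef_sym (restr_init L) xy.2 *
            symb coef_sym (K := restr_ext L) a }.

Section Delta.
Variables (k : fieldType) (A : coefficients k) (n : nat).

(* The defining property of alpha^(1): alpha(phi q) = f_1(phi) alpha^(1)(q). *)
Definition is_Delta (alpha : InvNorm (Inr k n 1) A)
    (beta : InvNorm (In k (n - 1)) A) : Prop :=
  forall (K : extension k) (phi : Pf k 1 K) (q : In k (n - 1) K),
    alpha K (Pf1_mul phi q) = f1 A (Pf1_I phi) * beta K q.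

Lemma f1_1 (K : extension k) : f1 A (pf1_I (nonzero1 K)) = 0.
Proof.
have [f [fD _ fa]] := coef_fn A K (leqnn 1).
have sE := fa (pf1_I (nonzero1 K)) [tuple nonzero1 K] (esym (pfister1 _)).
have : f (pf1_I (nonzero1 K)) = f (pf1_I (nonzero1 K)) + f (pf1_I (nonzero1 K)).
  by apply: fD; rewrite /= pf1_1 addr0.
rewrite sE /symb big_seq1 -[X in X = _]addr0 => /addrI <-.
by [].
Qed.

Lemma Pf1P (K : extension k) (phi : Pf k 1 K) : exists a, sval phi = pf1 a.
Proof.
by case: phi => x [a xa]; have [b ab] := tuple1P a; exists b; rewrite /= xa ab pfister1.
Qed.

Lemma sf_map_Pf1_mul (K L : extension k) (s : ext_hom K L) phi q :
  sf_map s (Pf1_mul (n := n) phi q) = Pf1_mul (sf_map s phi) (sf_map s q).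
Proof. by apply: subGW_eq; rewrite /= rmorphM. Qed.

Section OneInvariant.
Variable alpha : InvNorm (Inr k n 1) A.

(* The value y = alpha^(1)(q): the unique y in A(K) such that
   alpha(phi q_L) = f_1(phi) y_L for all L/K and phi in Pf_1(L). *)
Definition slice (K : extension k) (q : In k (n - 1) K) (y : A K) : Prop :=
  forall (L : extension k) (s : ext_hom K L) (phi : Pf k 1 L),
    alpha L (Pf1_mul phi (sf_map s q)) = f1 A (Pf1_I phi) * rf_map A s y.

Section Base.
Variables (K : extension k) (q : In k (n - 1) K).

Definition base_fun (L : extension K) (phi : Pf K 1 L) : A (restr_ext L) :=
  alpha (restr_ext L) (Pf1_mul (phi : Pf k 1 (restr_ext L)) (sf_map (restr_init L) q)).

Lemma base_fun_nat (L M : extension K) (s : ext_hom L M) phi :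
  base_fun (sf_map s phi) = rf_map (restr_ring K A) s (base_fun phi).
Proof.
rewrite /= /base_fun -inv_nat sf_map_Pf1_mul; congr (alpha _ (Pf1_mul _ _)).
have := @sf_map_comp _ (In k (n - 1)) _ _ _ (restr_init L) (restr_hom s) (restr_init M).
by move=> -> // x /=; rewrite ext_homP.
Qed.

Definition base_inv : Inv (Pf K 1) (restr_ring K A) :=
  @Invariant K (Pf K 1) (restr_ring K A) base_fun base_fun_nat.
End Base.

Section Over.
Variables (K L : extension k) (s : ext_hom K L).

Definition over_ext : extension K := @Extension K L s.

Definition over_to : ext_hom (restr_ext over_ext) L :=
  @ExtHom k (restr_ext over_ext) L (idfun : {rmorphism L -> L}) (ext_homP s).
End Over.

Lemma slice_base (K : extension k) (q : In k (n - 1) K) y : slice q y <->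
  forall (L : extension K) (a : 1.-tuple (nonzero L)),
    base_inv q L (pfister_elt a) =
      rf_map A (restr_init L) 0 +
      rf_map A (restr_init L) y * symb A (K := restr_ext L) a.
Proof.
split=> [qy L a|qy L s phi].
  rewrite rmorph0 add0r [LHS]qy mulrC; congr (_ * _).
  have [b ->] := tuple1P a.
  by rewrite /symb big_seq1; congr (f1 A _); apply: subGW_eq; rewrite /= pfister1.
have [b phib] := Pf1P phi.
have := qy (over_ext s) [tuple b]; rewrite /= /base_fun.
move=> /(congr1 (rf_map A (over_to s))).
rewrite rmorph0 add0r /symb big_seq1 rmorphM -f1_nat -inv_nat.
rewrite sf_map_Pf1_mul => E.
have idE := @GW_map_id L (idfun : {rmorphism L -> L}) (fun x => erefl).
have -> : phi = sf_map (over_to s) (pfister_elt [tuple b] : Pf k 1 (restr_ext (over_ext s))).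
  by apply: subGW_eq; rewrite /= idE phib pfister1.
rewrite -[X in Pf1_mul _ X]/(sf_map s q).
have -> : sf_map s q = sf_map (over_to s) (sf_map (restr_init (over_ext s)) q).
  by apply: sf_map_comp.
rewrite E mulrC; congr (_ * _).
  by congr (f1 A _); apply: subGW_eq; rewrite /= pfister1.
by apply/esym/rf_map_comp.
Qed.

Lemma slice_exists (K : extension k) (q : In k (n - 1) K) : exists! y, slice q y.
Proof.
have [[x y] [xyE xyU]] := coef_inv (leqnn 1) (base_inv q).
have x0 : x = 0.
  pose i := @ExtHom k K K (idfun : {rmorphism K -> K}) (fun=> erefl).
  have := xyE (over_ext i) [tuple nonzero1 K].
  rewrite /symb big_seq1 [f1 _ _](f1_1 (restr_ext (over_ext i))) mulr0 addr0 /= /base_fun.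
  set z := Pf1_mul _ _.
  have -> : z = pf_point (Inr k n 1) _.
    by apply: subGW_eq; rewrite /= pfister1 pf1_1 mul0r.
  rewrite inv_normP => /(congr1 (rf_map A (over_to i))); rewrite rmorph0 => ->.
  by rewrite -[LHS](@rf_map_id _ A _ i) //; apply: rf_map_comp.
exists y; split; first by apply/slice_base; rewrite -x0.
by move=> z /slice_base zE; have := xyU (0, z) zE => -[].
Qed.

Definition Delta_fun (K : extension k) (q : In k (n - 1) K) : A K :=
  sval (cid (slice_exists q)).

Lemma Delta_funP (K : extension k) (q : In k (n - 1) K) : slice q (Delta_fun q).
Proof. by rewrite /Delta_fun; case: cid => y []. Qed.

Lemma slice_unique (K : extension k) (q : In k (n - 1) K) y z :
  slice q y -> slice q z -> y = z.
Proof. by have [t [_ tU]] := slice_exists q; move=> /tU <- /tU. Qed.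

Lemma Delta_fun_nat (K L : extension k) (s : ext_hom K L) (q : In k (n - 1) K) :
  Delta_fun (sf_map s q) = rf_map A s (Delta_fun q).
Proof.
apply: slice_unique (Delta_funP _) _ => M t phi.
have [u uE] : exists u : ext_hom K M, u =1 t \o s.
  have c x : t (s (ext_map K x)) = ext_map M x by rewrite !ext_homP.
  by exists (@ExtHom k K M (t \o s : {rmorphism K -> M}) c).
have -> : sf_map t (sf_map s q) = sf_map u q by apply/esym/sf_map_comp.
have -> : rf_map A t (rf_map A s (Delta_fun q)) = rf_map A u (Delta_fun q).
  by apply/esym/rf_map_comp.
exact: Delta_funP.
Qed.

Lemma Delta_fun_norm (K : extension k) : Delta_fun (pf_point (In k (n - 1)) K) = 0.
Proof.
apply: slice_unique (Delta_funP _) _ => L s phi.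
rewrite pf_point_map rmorph0 mulr0 -[RHS](inv_normP alpha L); congr (alpha _ _).
by apply: subGW_eq; rewrite /= mulr0.
Qed.

(* Delta^{n,1}(alpha) = alpha^(1); see DeltaP and Delta_unique. *)
Definition Delta : InvNorm (In k (n - 1)) A :=
  @NormInvariant k (In k (n - 1)) A 
    (@Invariant k (In k (n - 1)) A Delta_fun Delta_fun_nat)
    Delta_fun_norm.

End OneInvariant.

Lemma DeltaP alpha : is_Delta alpha (Delta alpha).
Proof.
move=> K phi q.
pose i := @ExtHom k K K (idfun : {rmorphism K -> K}) (fun=> erefl).
have := Delta_funP alpha q i phi.
by rewrite (@sf_map_id _ (In k (n - 1)) _ i) // (@rf_map_id _ A _ i).
Qed.

Lemma Delta_unique alpha beta : is_Delta alpha beta -> beta = Delta alpha.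
Proof.
move=> H; apply: InvNorm_eq => K q; apply: (@slice_unique alpha K q).
  by move=> L s phi; rewrite H inv_nat.
exact: Delta_funP.
Qed.

End Delta.

(* Main.v *)
Require Import Defs.
From mathcomp Require Import all_boot all_order all_algebra.
From HB Require Import structures.
From mathcomp Require Import ring zify boolp mxtens.

Set Implicit Arguments.
Unset Strict Implicit.
Unset Printing Implicit Defensive.
Import GRing.Theory.
Local Open Scope ring_scope.

(** Every element of [I^{n,1}] is a product [phi q], so an invariant of [I^{n,1}]
   is determined by its image under [Delta].  The content is surjectivity: for a
   normalized invariant [beta] of [I^m], [m = n - 1], the formula
   [phi q |-> f_1 (phi) beta (q)] must be well defined, that is,
   [<<a>> q = <<b>> r] must imply [{a} beta (q) = {b} beta (r)]
   ([inv_value_linkage]).  Then it defines a preimage of [beta].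

   Two observations reduce this to the Grothendieck-Witt ring.  First, since all
   invariants of [Pf_m] are affine in [f_m], there is an invariant [Phi beta]
   with [beta (q + psi) = beta (q) + f_m (psi) (Phi beta) (q)] for [psi] in
   [Pf_m].  Iterating, [beta (y + psi_1 + ... + psi_l)] is the sum over [d] of
   [(Phi^d beta) (y) e_d (f_m (psi_1), ..., f_m (psi_l))], where [e_d] is the
   elementary symmetric function ([inv_expansion]).  Second, by additivity of
   [f_(m d + 1)], the product [{a} e_d (f_m (psi_1), ..., f_m (psi_l))] is the
   image of [<<a>> e_d (psi_1, ..., psi_l)] ([symb_elemsym]).  Choosing [y] such
   that [q], [r] and [0] are all sums of [y] and of Pfister elements, it remains
   to prove for lists [X], [Y], [Z] of m-fold Pfister elements that
   [<<a>> (e_d (X) - e_d (Z)) = <<b>> (e_d (Y) - e_d (Z))] for all [d] as soon as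
   this holds for [d = 1] ([pfister_linkage]).

   Symmetric functions are handled through the generating polynomial
   [(1 + psi_1 t) ... (1 + psi_l t)].  The number of slots is lowered by the
   identity [<<b>> + <<c>> = <<b c>> + <<b, c>>], whose multiplicative form is
   [(1 + s <<b>> t) (1 + s <<c>> t) = (1 + s <<b c>> t) (1 + s <<b, c>> t')] with
   [s] an m-fold Pfister element and [t' = t + 2^m t^2] ([pfister_relation]).
   For one slot, [pfpoly_linkage] is a statement about diagonal forms with
   [<1, -a> C = <1, -b> D].  If [a = b], elementary changes of [C] which preserve
   [<<a>> (1 + <<c_1>> t) ... (1 + <<c_l>> t)] lead from [C] to [D].  Otherwise
   such changes make [C] and [D] equal and composed of pairs [<d, u>] with
   [<1, -a> <d, u> = <1, -b> <d, u>].  All of this rests on Witt cancellation and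
   on following the values that the forms represent. *)

(** * Diagonal forms and Witt cancellation *)

Section Forms.
Variable F : fieldType.
Implicit Types (p q : qform F) (x y z : isoclass F) (a b c d e : nonzero F).

Definition diag a : isoclass F := qclass (qdiag a).

(** Gram matrices of nondegenerate forms being invertible, a congruence between
   forms of the same dimension has an invertible matrix. *)
Lemma isometric_congr p q (U : 'M_(qdim p, qdim q)) :
  qdim p = qdim q -> U *m gram q *m U^T = gram p -> isometric p q.
Proof.
case: p q U => [m A symA unitA] [n B symB unitB] /= U E.
subst n => UBU.
have UU' : U *m (B *m U^T *m invmx A) = 1%:M by rewrite !mulmxA UBU mulmxV.
by exists U, (B *m U^T *m invmx A); split; rewrite ?(mulmx1C UU').
Qed.

(** Write an isometry as a block matrix with rows [u, v] and [w, W], where [u] is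
   a scalar.  The rank one correction [W + t w v] is an isometry of the
   complements as soon as [1 + 2 t u = t ^ 2 (1 - u ^ 2)].  The roots of this
   equation are [1 / (1 - u)] and [- 1 / (1 + u)], and in characteristic
   different from 2 at least one of them makes sense. *)
Lemma witt_cancellation c x y :
  (2 : F) != 0 -> diag c + x = diag c + y -> x = y.
Proof.
move=> F2; elim/qclass_ind: x => p; elim/qclass_ind: y => q.
rewrite ![_ + _]qclassD => /qclassP pq; apply/qclassP.
have /eqP := qdim_isom pq; rewrite eqn_add2l => /eqP dimE.
case: pq => P [_ [_ _]]; rewrite -[P](submxK P) tr_block_mx.
set u := ulsubmx P; set v := ursubmx P; set w := dlsubmx P; set W := drsubmx P.
rewrite /= !mulmx_block !(mulmx0, addr0, add0r) => /eq_block_mx[Eu _ Ewu EW].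
have [t tE] : exists t : F, 1 + 2 * t * u 0 0 = t ^+ 2 * (1 - u 0 0 ^+ 2).
  have [u1|u1] := eqVneq (u 0 0) 1; last first.
    exists (1 - u 0 0)^-1; field.
    by rewrite subr_eq0 eq_sym.
  by exists (- 2^-1); rewrite u1; field.
(* The upper blocks give [v M v^T = c (1 - u ^ 2)] and [W M v^T = - c u w]. *)
have {}Eu : v *m gram q *m v^T = (sval c * (1 - u 0 0 ^+ 2))%:M.
  apply/eqP; rewrite mulrBr raddfB /= mulr1 -Eu eq_sym subr_eq eq_sym addrC.
  apply/eqP; congr (_ + _); rewrite [in RHS](mx11_scalar u) tr_scalar_mx.
  by rewrite -!scalar_mxM; congr (_%:M); ring.
have {}Ewu : W *m gram q *m v^T = - (sval c * u 0 0) *: w.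
  apply/eqP; rewrite scaleNr -addr_eq0 addrC -[X in _ == X]Ewu; apply/eqP.
  congr (_ + _); rewrite [in RHS](mx11_scalar u) tr_scalar_mx -mulmxA.
  by rewrite -scalar_mxM mul_mx_scalar.
have Evw : v *m gram q *m W^T = - (sval c * u 0 0) *: w^T.
  by move/(congr1 trmx): Ewu; rewrite !trmx_mul trmxK gram_sym mulmxA linearZ.
apply: (@isometric_congr p q (W + t *: (w *m v))) => //.
rewrite -EW linearD linearZ /= trmx_mul !(mulmxDl, mulmxDr) mul_mx_scalar.
rewrite -!(scalemxAl, scalemxAr) !mulmxA Ewu.
have -> : w *m v *m gram q *m W^T = - (sval c * u 0 0) *: (w *m w^T).
  by rewrite -!mulmxA (mulmxA v) Evw scalemxAr.
have -> : w *m v *m gram q *m v^T *m w^T =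
    (sval c * (1 - u 0 0 ^+ 2)) *: (w *m w^T).
  by rewrite -(mulmxA w v) -(mulmxA w) Eu mul_mx_scalar scalemxAl.
rewrite -scalemxAl !scalerA -addrA addrC -!scalerDl; congr (_ *: _ + _).
have t_coef (l r : F) : 1 + 2 * t * r = t ^+ 2 * (1 - r ^+ 2) ->
  t * - (l * r) + (t * - (l * r) + t * t * (l * (1 - r ^+ 2))) = l.
  move=> rE; transitivity (l * (t ^+ 2 * (1 - r ^+ 2) - 2 * t * r)); first ring.
  by rewrite -rE; ring.
exact: t_coef.
Qed.

Lemma scalar_mx1_inj (f g : F) : f%:M = g%:M :> 'M_1 -> f = g.
Proof. by move/matrixP/(_ 0 0); rewrite !mxE. Qed.

Definition represents x (e : F) := exists v : 'rV_(qdim (repr x)),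
  v *m gram (repr x) *m v^T = e%:M.

Lemma representsP p (e : F) : represents (qclass p) e <->
  exists v : 'rV_(qdim p), v *m gram p *m v^T = e%:M.
Proof.
have transfer q r : isometric q r ->
    (exists v : 'rV_(qdim q), v *m gram q *m v^T = e%:M) ->
  exists v : 'rV_(qdim r), v *m gram r *m v^T = e%:M.
  case=> P [_ [_ _ <-]] [v vE]; exists (v *m P).
  by rewrite trmx_mul -vE !mulmxA.
have pE : isometric (repr (qclass p)) p by apply/qclassP/qclass_repr.
by split; apply: transfer; last exact: isometric_sym.
Qed.

Lemma represents_add x y (e : F) : represents (x + y) e ->
  exists f g : F, [/\ represents x f, represents y g & e = f + g].
Proof.
elim/qclass_ind: x => p; elim/qclass_ind: y => q.
rewrite [_ + _]qclassD => /representsP[v].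
rewrite -[v]hsubmxK; set f := lsubmx v; set g := rsubmx v.
rewrite /= tr_row_mx mul_row_block mul_row_col !(mulmx0, addr0, add0r) => E.
exists ((f *m gram p *m f^T) 0 0), ((g *m gram q *m g^T) 0 0); split.
- by apply/representsP; exists f; rewrite -mx11_scalar.
- by apply/representsP; exists g; rewrite -mx11_scalar.
by apply: scalar_mx1_inj; rewrite raddfD /= -!mx11_scalar E.
Qed.

Lemma represents_diag c (e : F) :
  represents (diag c) e -> exists y : F, e = sval c * y ^+ 2.
Proof.
case/representsP=> v; rewrite [v]mx11_scalar /= tr_scalar_mx -!scalar_mxM.
by move/scalar_mx1_inj=> <-; exists (v 0 0); rewrite expr2 mulrCA mulrA.
Qed.

Lemma represents0 (e : F) : represents 0 e -> e = 0.
Proof.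
case/representsP=> v; rewrite (thinmx0 v) !mul0mx.
by rewrite -[0](raddf0 (@scalar_mx F 1)) => /scalar_mx1_inj.
Qed.

Lemma represents_diagD c x : represents (diag c + x) (sval c).
Proof.
elim/qclass_ind: x => p; rewrite [_ + _]qclassD; apply/representsP.
exists (row_mx (1%:M : 'M_1) 0).
rewrite /= tr_row_mx mul_row_block mul_row_col trmx1 trmx0.
by rewrite !(mulmx0, mul0mx, addr0, add0r) mul1mx mulmx1.
Qed.

(** The complement is carried by the kernel of the linear form [w |-> w M v^T],
   which does not contain [v] because [v] is anisotropic. *)
Lemma split_off p e (v : 'rV_(qdim p)) :
    v *m gram p *m v^T = (sval e)%:M ->
  exists q, isometric (qsum (qdiag e) q) p.
Proof.
move=> vE; pose A := gram p *m v^T; pose N := row_base (kermx A).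
have NA : N *m A = 0 by apply/sub_kermxP; rewrite eq_row_base.
have freeN : row_free N := row_base_free _.
clearbody N.
have vA : v *m A = (sval e)%:M by rewrite /A mulmxA.
have rkA : \rank A = 1%N.
  apply/eqP; rewrite eqn_leq rank_leq_col lt0n mxrank_eq0.
  apply: contraTneq (svalP e) => A0; move: vA; rewrite A0 mulmx0.
  by rewrite -[0](raddf0 (@scalar_mx F 1)) => /scalar_mx1_inj <-; rewrite eqxx.
have n0 : (0 < qdim p)%N by rewrite -rkA rank_leq_row.
have dimE : (1 + \rank (kermx A))%N = qdim p.
  by rewrite mxrank_ker rkA subnKC.
pose P := col_mx v N.
have freeP : row_free P.
  apply: inj_row_free => w; rewrite -[w]hsubmxK mul_row_col.
  set f := lsubmx w; set g := rsubmx w => E.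
  have f0 : f = 0.
    move/(congr1 (mulmx^~ A)): (E); rewrite /= mulmxDl.
    rewrite -(mulmxA f) -(mulmxA g) NA vA mulmx0 addr0.
    rewrite mul_mx_scalar mul0mx => /eqP; rewrite scaler_eq0 (negPf (svalP e)).
    by move/eqP.
  rewrite f0 mul0mx add0r in E; suff -> : g = 0 by rewrite f0 row_mx0.
  by apply: (row_free_inj freeN); rewrite mul0mx.
have block : P *m gram p *m P^T =
    block_mx (sval e)%:M 0 0 (N *m gram p *m N^T).
  rewrite tr_col_mx mul_col_mx mul_col_row vE -!(mulmxA N) NA.
  rewrite -[v *m gram p *m N^T]trmxK trmx_mul [(v *m _)^T]trmx_mul trmxK.
  by rewrite gram_sym NA trmx0.
have unitP : P *m gram p *m P^T \in unitmx.
  rewrite -row_free_unit /row_free mxrankMfree; last first.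
    by rewrite /row_free mxrank_tr (eqP freeP) dimE.
  by rewrite mxrankMfree ?(eqP freeP) // row_free_unit gram_unit.
have symN : (N *m gram p *m N^T)^T = N *m gram p *m N^T.
  by rewrite !trmx_mul trmxK gram_sym mulmxA.
have unitN : N *m gram p *m N^T \in unitmx.
  by move: unitP; rewrite block !unitmxE det_ublock unitrM => /andP[].
pose q := QForm symN unitN.
by exists q; apply: (@isometric_congr (qsum (qdiag e) q) p P).
Qed.

Lemma represents_split x e : represents x (sval e) -> exists y, x = diag e + y.
Proof.
elim/qclass_ind: x => p /representsP[v /split_off[q pq]]; exists (qclass q).
by rewrite [_ + _]qclassD; apply/qclassP/isometric_sym.
Qed.

(** If every vector is isotropic, polarization makes the bilinear form vanish,
   since 2 is invertible. *)
Lemma anisotropic_vector p : (2 : F) != 0 -> (0 < qdim p)%N ->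
  exists (v : 'rV_(qdim p)) e, v *m gram p *m v^T = (sval e)%:M.
Proof.
move=> F2; case: p => [[//|n] M symM unitM] _ /=.
pose B (v w : 'rV_n.+1) : F := (v *m M *m w^T) 0 0.
suff [v Bv] : exists v, B v v != 0.
  by exists v, (exist (fun b : F => b != 0) _ Bv); rewrite -mx11_scalar.
apply: contrapT => noB; have {}noB v : B v v = 0.
  by apply/eqP/negPn/negP => Bv; apply: noB; exists v.
have BC v w : B v w = B w v.
  rewrite /B -[v *m M *m w^T]trmxK mxE.
  by rewrite trmx_mul [(v *m _)^T]trmx_mul trmxK symM mulmxA.
have BD v w : B (v + w) (v + w) = B v v + B v w + (B w v + B w w).
  by rewrite /B raddfD mulmxDl mulmxDl !mulmxDr ![(_ + _ : 'M_1) 0 0]mxE.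
have B0 v w : B v w = 0.
  apply/eqP; move: (BD v w); rewrite !noB add0r addr0 (BC w v) => /eqP.
  by rewrite eq_sym -mulr2n -mulr_natl mulf_eq0 (negPf F2).
have := B0 (delta_mx 0 0) (invmx M *m delta_mx 0 0)^T.
rewrite /B trmxK -mulmxA (mulmxA M) mulmxV // mul1mx mul_delta_mx mxE !eqxx.
by move/eqP; rewrite oner_eq0.
Qed.

Lemma diagonalization x :
  (2 : F) != 0 -> exists s : seq (nonzero F), x = \sum_(c <- s) diag c.
Proof.
move=> F2; elim/qclass_ind: x => p; have [n pn] := ubnP (qdim p).
elim: n p pn => // n IH p pn.
have [p0|/(anisotropic_vector F2)[v [e /split_off[q qp]]]] := posnP (qdim p).
  exists [::]; rewrite big_nil; apply/qclassP.
  apply: (@isometric_congr p (qzero F) 0) => //; rewrite mul0mx.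
  by apply/matrixP => i; have := ltn_ord i; rewrite {2}p0.
have [|s sE] := IH q; first by move: pn; rewrite -(qdim_isom qp).
exists (e :: s); rewrite big_cons -sE [RHS]qclassD; apply/qclassP.
exact: isometric_sym.
Qed.

Lemma cancel_class x y z : (2 : F) != 0 -> x + z = y + z -> x = y.
Proof.
move=> F2; have [s ->] := diagonalization z F2.
elim: s => [|c s IH]; rewrite ?big_nil ?addr0 // big_cons.
by rewrite (addrCA x) (addrCA y) => /(witt_cancellation F2)/IH.
Qed.

(** An equality in the Grothendieck-Witt ring between classes of actual forms is
   an isometry, so vectors of these forms can be used to exploit it. *)
Lemma to_groth_inj : (2 : F) != 0 -> injective (@to_groth (isoclass F)).
Proof.
move=> F2 x y /gdiffP[z]; rewrite !addr0; exact: cancel_class.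
Qed.

End Forms.

(** * Rank one forms and slots *)

Lemma GW_oner_neq0 (F : fieldType) : (1 : GW F) != 0.
Proof.
apply/eqP => /(congr1 (vdim F)) /eqP.
by rewrite [X in X == _ -> _]rmorph1 [X in _ == X -> _]rmorph0.
Qed.

(* Polynomials need a nontrivial ring of coefficients. *)
HB.instance Definition _ (F : fieldType) :=
  GRing.PzSemiRing_isNonZero.Build (groth (isoclass F)) (GW_oner_neq0 F).

(* Fractions have a [nonzero1] too. *)
Local Notation nonzero1 := Defs.nonzero1.

Section Linkage.
Variable F : fieldType.
Hypothesis F2 : (2 : F) != 0.
Implicit Types (a b c d e g : nonzero F) (C D : seq (nonzero F)).

Definition nzM a b : nonzero F :=
  exist _ (sval a * sval b) (mulf_neq0 (svalP a) (svalP b)).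

Lemma nzN_subproof a : - sval a != 0.
Proof. by rewrite oppr_eq0 (svalP a). Qed.

Definition nzN a : nonzero F := exist _ (- sval a) (nzN_subproof a).

Definition nzN1 := nzN (nonzero1 F).

Lemma form1_eq a b (y : F) : sval a = sval b * y ^+ 2 -> form1 a = form1 b.
Proof.
move=> E; congr to_groth; apply/qclassP.
apply: (@isometric_congr _ (qdiag a) (qdiag b) y%:M) => //=.
rewrite tr_scalar_mx -!scalar_mxM [sval a]E expr2 mulrA.
by congr (_ * _)%:M; rewrite mulrC.
Qed.

Lemma form1M a b : form1 (nzM a b) = form1 a * form1 b.
Proof.
rewrite /form1 -rmorphM [_ * _]qclassM; congr to_groth; apply/qclassP.
apply: (@isometric_reindex _ (qdiag (nzM a b)) (qprod (qdiag a) (qdiag b))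
  id id) => // i j.
rewrite !mxE !(ord1 (mxtens_unindex _).1) !(ord1 (mxtens_unindex _).2).
by rewrite !(ord1 i) !(ord1 j) !mulr1n.
Qed.

(** A binary form is determined by its determinant and one represented value:
   [(- e z, c y)] is orthogonal to [(y, z)]. *)
Lemma form1_binary c e d g (y z : F) :
    sval d = sval c * y ^+ 2 + sval e * z ^+ 2 ->
    sval g = sval c * sval e * sval d ->
  form1 c + form1 e = form1 d + form1 g.
Proof.
move=> dE gE; rewrite /form1 -!rmorphD; congr to_groth.
rewrite [LHS]qclassD [RHS]qclassD; apply/esym/qclassP.
apply: (@isometric_congr _ (qsum (qdiag d) (qdiag g)) (qsum (qdiag c) (qdiag e))
  (block_mx y%:M z%:M (- (sval e * z))%:M (sval c * y)%:M)) => //=.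
rewrite tr_block_mx !tr_scalar_mx !mulmx_block !(mulmx0, mul0mx, addr0, add0r).
have scalar0 (t : F) : t = 0 -> t%:M = 0 :> 'M_1 by move=> ->; rewrite raddf0.
rewrite -!scalar_mxM -!raddfD /=.
congr block_mx; [congr _%:M|apply: scalar0|apply: scalar0|congr _%:M];
  rewrite ?[sval g]gE ?[sval d]dE /=; ring.
Qed.

Lemma form1_square a : form1 a * form1 a = 1.
Proof.
rewrite -form1M -form1_1; apply: (@form1_eq _ _ (sval a)).
by rewrite /= mul1r expr2.
Qed.

Lemma form1N a : form1 (nzN a) = form1 nzN1 * form1 a.
Proof. by rewrite -form1M; apply: (@form1_eq _ _ 1); rewrite /=; ring. Qed.

Lemma form1_hyperbolic c : form1 c + form1 (nzN c) = 1 + form1 nzN1.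
Proof.
have c0 := svalP c; pose d := nzM c (nzM (nzN c) (nonzero1 F)).
have <- : form1 d = form1 nzN1.
  by apply: (@form1_eq _ _ (sval c)); rewrite /=; ring.
(* For [y + z = 1 / c] and [y - z = 1], the form has the value 1 at [(y, z)]. *)
rewrite -form1_1; pose t := (sval c)^-1.
apply: (@form1_binary _ _ _ _ ((t + 1) / 2) ((t - 1) / 2)).
  by rewrite /= /t; field; rewrite c0 F2.
by rewrite /=; ring.
Qed.

Lemma pf1_hyperbolic a : pf1 a * (1 + form1 nzN1) = 0.
Proof.
transitivity (1 + form1 nzN1 - (form1 a + form1 (nzN a))).
  by rewrite /pf1 form1_1 form1N; ring.
by rewrite form1_hyperbolic subrr.
Qed.

Lemma form1_nzN_pf1 a : 1 + form1 (nzN a) = pf1 a + (1 + form1 nzN1).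
Proof. by rewrite /pf1 form1_1 -(form1_hyperbolic a); ring. Qed.

Definition sumform C : GW F := \sum_(c <- C) form1 c.

Lemma hyperbolic_sumform C :
  (1 + form1 nzN1) * sumform C = (1 + form1 nzN1) *+ size C.
Proof.
rewrite /sumform; elim: C => [|c C IH]; first by rewrite big_nil mulr0.
rewrite big_cons mulrDr IH mulrS; congr (_ + _).
by rewrite mulrDl mul1r -form1N form1_hyperbolic.
Qed.

(** The class of the tensor product of [<1, -a>] with the diagonal form [C],
   which up to hyperbolic planes is [<<a>> C], see [norm_class_eq]. *)
Definition norm_class a C : isoclass F :=
  \sum_(c <- C) (diag c + diag (nzN (nzM a c))).

Lemma norm_classE a C :
  to_groth (norm_class a C) = (1 + form1 (nzN a)) * sumform C.
Proof.
rewrite rmorph_sum mulr_sumr; apply: eq_bigr => c _.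
rewrite rmorphD mulrDl mul1r -form1M /=; congr (_ + _).
by apply: (@form1_eq _ _ 1); rewrite /=; ring.
Qed.

Lemma norm_class_eq a b C D : size C = size D ->
  norm_class a C = norm_class b D <-> pf1 a * sumform C = pf1 b * sumform D.
Proof.
move=> sCD.
have E : to_groth (norm_class a C) - to_groth (norm_class b D) =
    pf1 a * sumform C - pf1 b * sumform D.
  rewrite !norm_classE (form1_nzN_pf1 a) (form1_nzN_pf1 b).
  rewrite !(mulrDl (pf1 _)) !hyperbolic_sumform sCD.
  by rewrite opprD addrACA subrr addr0.
split=> [H|/eqP]; first by apply/eqP; rewrite -subr_eq0 -E H subrr.
by rewrite -subr_eq0 -E subr_eq0 => /eqP/(to_groth_inj F2).
Qed.

(** That is, [<<a>>] does not see norms from the quadratic extension given by a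
   square root of [a]. *)
Lemma pf1_form1_represents a c d :
    represents (diag c + diag (nzN (nzM a c))) (sval d) ->
  pf1 a * form1 c = pf1 a * form1 d.
Proof.
case/represents_add=> _ [_ [/represents_diag[y ->] /represents_diag[z ->] dE]].
have := form1_binary dE (erefl (sval (nzM (nzM c (nzN (nzM a c))) d))).
have -> : form1 (nzM (nzM c (nzN (nzM a c))) d) = form1 (nzN (nzM a d)).
  by apply: (@form1_eq _ _ (sval c)); rewrite /=; ring.
have NM b : form1 b + form1 (nzN (nzM a b)) =
    pf1 a * form1 b + (1 + form1 nzN1).
  by rewrite -(form1_hyperbolic (nzM a b)) form1M /pf1 form1_1; ring.
by rewrite !NM => /addIr.
Qed.

(** * Generating polynomials over the Grothendieck-Witt ring *)

(** Its coefficients are the elementary symmetric functions of [X]. *)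
Definition pfpoly (X : seq (GW F)) : {poly GW F} :=
  \prod_(x <- X) (1 + x *: 'X).

Local Notation dpoly C := (pfpoly [seq pf1 c | c <- C]).

Lemma pfpoly_cons x X : pfpoly (x :: X) = (1 + x *: 'X) * pfpoly X.
Proof. exact: big_cons. Qed.

Lemma pfpoly_cat X Y : pfpoly (X ++ Y) = pfpoly X * pfpoly Y.
Proof. exact: big_cat. Qed.

Lemma linear_prod (R : comNzRingType) (x y : R) :
  (1 + x *: 'X) * (1 + y *: 'X) = 1 + (x + y) *: 'X + (x * y) *: 'X^2.
Proof. by rewrite -!mul_polyC rmorphD rmorphM /=; ring. Qed.

Lemma scale_pfpoly_cons (t x y : GW F) X Y : t * x = t * y ->
  t *: pfpoly X = t *: pfpoly Y -> t *: pfpoly (x :: X) = t *: pfpoly (y :: Y).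
Proof.
move=> xy XY; rewrite !pfpoly_cons scalerAr XY -scalerAr !scalerAl.
by congr (_ * _); rewrite !scalerDr !scalerA xy.
Qed.

Lemma pfpoly_binary c e d g :
    form1 c + form1 e = form1 d + form1 g ->
    form1 c * form1 e = form1 d * form1 g ->
  forall X, pfpoly [:: pf1 c, pf1 e & X] = pfpoly [:: pf1 d, pf1 g & X].
Proof.
move=> sumE prodE X; rewrite !pfpoly_cons !mulrA !linear_prod.
suff [-> ->] : pf1 c + pf1 e = pf1 d + pf1 g /\
  pf1 c * pf1 e = pf1 d * pf1 g by [].
have pf1D u v : pf1 u + pf1 v = 2 - (form1 u + form1 v).
  by rewrite /pf1 form1_1; ring.
have pf1M u v : pf1 u * pf1 v = 1 - (form1 u + form1 v) + form1 u * form1 v.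
  by rewrite /pf1 form1_1; ring.
by rewrite !pf1D !pf1M sumE prodE.
Qed.

Lemma pfpoly_swap x y X : pfpoly [:: x, y & X] = pfpoly [:: y, x & X].
Proof. by rewrite !pfpoly_cons mulrCA. Qed.

Lemma pf1_cancel a c d : pf1 a * form1 c = pf1 a * form1 d ->
  pf1 a * pf1 c = pf1 a * pf1 d.
Proof. by move=> cd; rewrite /(pf1 c) /(pf1 d) !mulrBr cd. Qed.

Lemma coef1_pfpoly X : (pfpoly X)`_0 = 1 /\ (pfpoly X)`_1 = \sum_(x <- X) x.
Proof.
elim: X => [|x X [IH0 IH1]]; first by rewrite /pfpoly !big_nil !coefC.
rewrite pfpoly_cons big_cons mulrDl mul1r -scalerAl !coefD !coefZ !coefXM /=.
by rewrite IH0 IH1 mulr0 addr0 mulr1 addrC.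
Qed.

Lemma sum_pf1 C : \sum_(x <- [seq pf1 c | c <- C]) x = (size C)%:R - sumform C.
Proof.
rewrite big_map /sumform; elim: C => [|c C IH]; first by rewrite !big_nil subrr.
by rewrite !big_cons IH /pf1 form1_1 /= mulrS; ring.
Qed.

Lemma pfpoly_sumform (t : GW F) C D : size C = size D ->
  t *: dpoly C = t *: dpoly D -> t * sumform C = t * sumform D.
Proof.
move=> sCD /(congr1 (fun p : {poly _} => p`_1)).
rewrite !coefZ !(coef1_pfpoly _).2 !sum_pf1 sCD !mulrBr.
by move/addrI/oppr_inj.
Qed.

(** Follow the partial sums of an expression of [d] as a value of [<1, -a> C]: the
   entries of [C] can be multiplied by norms without changing anything modulo
   the annihilator of [<<a>>], and then two entries [t], [w] with sum [d] can be
   replaced by [d], [t w d].  Both moves preserve [<<a>> dpoly C]. *)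
Lemma norm_class_represents a C d : represents (norm_class a C) (sval d) ->
  exists D, size C = (size D).+1 /\ pf1 a *: dpoly C = pf1 a *: dpoly (d :: D).
Proof.
rewrite /norm_class; elim: C d => [|c C IH] d.
  by rewrite big_nil => /represents0 d0; have := svalP d; rewrite d0 eqxx.
rewrite big_cons => /represents_add[u [v [repu repv dE]]].
have [v0|v_neq0] := eqVneq v 0.
  exists C; split=> //; apply: scale_pfpoly_cons => //.
  by apply/pf1_cancel/pf1_form1_represents; rewrite dE v0 addr0.
have {IH repv}[D [sizeD CD]] := IH (exist _ v v_neq0) repv.
set w : nonzero F := exist _ v v_neq0 in CD.
have [u0|u_neq0] := eqVneq u 0.
  have wd : w = d by apply: val_inj; rewrite /= dE u0 add0r.
  exists (c :: D); split; rewrite /= ?sizeD // pfpoly_swap -wd.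
  exact: scale_pfpoly_cons.
pose t : nonzero F := exist _ u u_neq0.
have ct : pf1 a * pf1 c = pf1 a * pf1 t.
  by apply/pf1_cancel/pf1_form1_represents.
exists (nzM (nzM t w) d :: D); split; first by rewrite /= sizeD.
rewrite (scale_pfpoly_cons ct CD); congr (_ *: _); apply: pfpoly_binary.
  by apply: (@form1_binary _ _ _ _ 1 1); rewrite //= dE; ring.
by rewrite !form1M [RHS]mulrC -[RHS]mulrA form1_square mulr1.
Qed.

(** For a fixed slot: bring the entries of [D] into [C] one at a time, cancelling
   them as soon as they agree. *)
Lemma pfpoly_same_slot a C D : size C = size D ->
  pf1 a * sumform C = pf1 a * sumform D -> pf1 a *: dpoly C = pf1 a *: dpoly D.
Proof.
elim: D C => [|d D IH] C sizeC CD; first by rewrite (size0nil sizeC).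
have [|C' [sizeC' CC']] := @norm_class_represents a C d.
  rewrite ((norm_class_eq a a sizeC).2 CD) /norm_class big_cons -addrA.
  exact: represents_diagD.
have sC' : size C' = size D by apply: succn_inj; rewrite -sizeC' sizeC.
rewrite CC'; apply: scale_pfpoly_cons => //; apply: IH => //.
have := pfpoly_sumform (D := d :: C') sizeC' CC'.
rewrite CD /sumform !big_cons !mulrDr.
by move/addrI/esym.
Qed.

(** [dpoly] of a hyperbolic plane [<g, - g>]. *)
Definition hyp_pol : {poly GW F} := 1 + pf1 nzN1 *: 'X.

(** Here [a], [b], [d], [w] stand for rank one forms and [h] for [<-1>]; the last
   hypothesis is [<- a d, w> = <- b d, a b w>]. *)
Lemma linkage_identity (R : comPzRingType) (a b d h w : R) :
    a * a = 1 -> d * d = 1 -> h * h = 1 ->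
    h * (a * d) + w = h * (b * d) + h * (a * d) * w * (h * (b * d)) ->
  (a - b) * (d + h * (a * w)) = 0.
Proof.
move=> a2 d2 h2 E.
transitivity (h * (h * (a * d) + w)
  - h * (h * (b * d) + h * (a * d) * w * (h * (b * d)))
  + (1 - h * h) * (a * d - b * d) + (a * a - 1) * (h * w)
  + (h * h * (d * d) - 1) * (h * a * b * w)); first by ring.
by rewrite E a2 d2 h2 mulr1 !subrr !mul0r !addr0.
Qed.

(** Let [<<a>> C = <<b>> D] with [<<a>>] and [<<b>>] distinct.  An entry [d] of
   [D] can be brought into [C].  After [d] is cancelled, [- b d] is a value
   [- a d y ^ 2 + w] of the remaining form, which yields [u = - a w] with
   [<1, -a> <d, u> = <1, -b> <d, u>]; this [u] can be brought into [C] and [D]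
   without changing the slots.  The two common entries split off and induction
   applies.  The factor [<<a>> - <<b>>] cannot distinguish [<d, u>] from a
   hyperbolic plane, whence the right-hand side. *)
Lemma pfpoly_linkage a b C D : size C = size D ->
    pf1 a * sumform C = pf1 b * sumform D ->
  pf1 a *: dpoly C - pf1 b *: dpoly D =
    (pf1 a - pf1 b) *: hyp_pol ^+ (size C)./2.
Proof.
have [ab|ab] := eqVneq (pf1 a) (pf1 b).
  move=> sizeC CD; rewrite -ab subrr scale0r.
  by rewrite (pfpoly_same_slot (D := D)) ?subrr // CD ab.
have [n sizeCn] := ubnP (size C); elim: n C D sizeCn => // n IH C D sizeCn.
case: D => [/size0nil-> _|d D sizeC CD].
  by rewrite expr0 [RHS]scalerBl /pfpoly !big_nil.
have [|C1 [sizeC1 CC1]] := @norm_class_represents a C d.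
  rewrite ((norm_class_eq a b sizeC).2 CD) /norm_class big_cons -addrA.
  exact: represents_diagD.
have CD1 := pfpoly_sumform (D := d :: C1) sizeC1 CC1.
have sC1 : size C1 = size D by apply: succn_inj; rewrite -sizeC1 sizeC.
have nE : norm_class a (d :: C1) = norm_class b (d :: D).
  by apply/norm_class_eq; rewrite /= ?sC1 // -CD1.
have {nE} : diag (nzN (nzM a d)) + norm_class a C1 =
            diag (nzN (nzM b d)) + norm_class b D.
  by apply: (witt_cancellation (c := d) F2); move: nE;
     rewrite /norm_class !big_cons !addrA.
have : represents (diag (nzN (nzM b d)) + norm_class b D) (- (sval b * sval d)).
  exact: (represents_diagD (nzN (nzM b d))).
move=> /[swap] nE; rewrite -nE.
move=> /represents_add[_ [v [/represents_diag[y ->] repv bdE]]].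
have [v0|v_neq0] := eqVneq v 0.
  (* Then [a] and [b] differ by a square. *)
  case/eqP: ab; rewrite /pf1; congr (_ - _); apply/esym/(@form1_eq _ _ y).
  apply: (mulIf (svalP d)); apply: oppr_inj; rewrite bdE v0 /=; ring.
pose w : nonzero F := exist _ v v_neq0.
have {repv}[C2 [sizeC2 C1C2]] := @norm_class_represents a C1 w repv.
pose u := nzN (nzM a w).
have wu : pf1 a * form1 w = pf1 a * form1 u.
  apply: pf1_form1_represents; rewrite addrC; exact: represents_diagD.
have {C1C2} C1E : pf1 a *: dpoly C1 = pf1 a *: dpoly (u :: C2).
  by rewrite C1C2; apply: scale_pfpoly_cons => //; apply: pf1_cancel.
have link : (form1 a - form1 b) * (form1 d + form1 u) = 0.
  rewrite [form1 u]form1N form1M.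
  apply: linkage_identity; rewrite ?form1_square //.
  rewrite -!form1M; apply: (@form1_binary _ _ _ _ y 1) => //.
  by rewrite /= expr1n mulr1 !mulN1r.
have {}link : (pf1 a - pf1 b) * (form1 d + form1 u) = 0.
  have -> : pf1 a - pf1 b = - (form1 a - form1 b) by rewrite /pf1; ring.
  by rewrite mulNr link oppr0.
have linkM : (pf1 a - pf1 b) * (1 + form1 d * form1 u) = 0.
  by rewrite -(form1_square d) -mulrDr mulrCA link mulr0.
have pfC : pf1 a * sumform C = pf1 a * sumform [:: d, u & C2].
  apply: pfpoly_sumform; rewrite /= -?sizeC2 ?sizeC1 // CC1.
  exact: scale_pfpoly_cons.
have pfD : pf1 b * sumform D = pf1 b * sumform [:: u] + pf1 a * sumform C2.
  have linkE : pf1 a * (form1 d + form1 u) = pf1 b * (form1 d + form1 u).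
    by apply/eqP; rewrite -subr_eq0 -mulrBl link.
  apply: (addrI (pf1 b * form1 d)); rewrite addrA /sumform big_seq1.
  rewrite -!(mulrDr (pf1 b)) -linkE -mulrDr -addrA.
  by move: pfC; rewrite CD /sumform !big_cons.
have nD : norm_class b D = norm_class b [:: u] + norm_class a C2.
  apply: (to_groth_inj F2); rewrite rmorphD /= !norm_classE.
  rewrite (form1_nzN_pf1 a) (form1_nzN_pf1 b) !(mulrDl (pf1 _)) pfD.
  rewrite !hyperbolic_sumform -sC1 sizeC2 /= addrACA; congr (_ + _).
  by rewrite mulrS mulr1n.
have [|D1 [sizeD1 DD1]] := @norm_class_represents b D u.
  rewrite nD /norm_class big_seq1 -addrA; exact: represents_diagD.
have sC2 : size C2 = size D1.
  by apply: succn_inj; rewrite -sizeC2 -sizeD1 sC1.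
have pfD1 := pfpoly_sumform (D := u :: D1) sizeD1 DD1.
have {pfD pfD1} pfC2 : pf1 a * sumform C2 = pf1 b * sumform D1.
  move: pfD1; rewrite pfD /sumform !big_cons big_nil addr0 mulrDr.
  by move/addrI.
have C2n : (size C2 < n)%N.
  by rewrite -ltnS (leq_trans _ sizeCn) // sizeC1 sizeC2 !ltnS leqnSn.
rewrite CC1 sizeC1 sizeC2 /= exprS scalerAl.
have -> : pf1 a *: dpoly (d :: C1) = pf1 a *: dpoly [:: d, u & C2].
  exact: scale_pfpoly_cons.
have -> : pf1 b *: dpoly (d :: D) = pf1 b *: dpoly [:: d, u & D1].
  exact: scale_pfpoly_cons.
rewrite /= !pfpoly_cons !mulrA !scalerAr -mulrBr (IH C2 D1) //.
rewrite -scalerAr scalerAl; congr (_ * _).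
rewrite linear_prod /hyp_pol !scalerDr -addrA; congr (_ + _).
rewrite !scalerA.
have -> : (pf1 a - pf1 b) * (pf1 d * pf1 u) = 0.
  rewrite (_ : pf1 d * pf1 u = 1 + form1 d * form1 u - (form1 d + form1 u)).
    by rewrite mulrBr link linkM subrr.
  by rewrite /pf1 form1_1; ring.
rewrite scale0r addr0; congr (_ *: _).
have -> : pf1 d + pf1 u = 2 - (form1 d + form1 u) by rewrite /pf1 form1_1; ring.
rewrite mulrBr link subr0.
have -> : pf1 nzN1 = 2 - (1 + form1 nzN1) by rewrite /pf1 form1_1; ring.
by rewrite mulrBr [X in _ = _ - X]mulrBl !pf1_hyperbolic !subr0.
Qed.

End Linkage.

(** * From diagonal forms to Pfister elements *)

Lemma poly_const1_regular (R : comNzRingType) (p q : {poly R}) :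
  p`_0 = 1 -> p * q = 0 -> q = 0.
Proof.
move=> p0 pq; apply/polyP => n; rewrite coef0; have [k nk] := ubnP n.
elim: k n nk => // k IH n nk.
have := congr1 (fun r : {poly R} => r`_n) pq.
rewrite coef0 coefM big_ord_recl p0 mul1r subn0 big1 ?addr0 // => i _.
rewrite IH ?mulr0 // lift0; apply: (@leq_trans n) => //.
by rewrite ltn_subrL (leq_ltn_trans _ (ltn_ord i)).
Qed.

Lemma comp_poly_quad_eq0 (R : comNzRingType) (c : R) (p : {poly R}) :
  p \Po ('X + c *: 'X^2) = 0 -> p = 0.
Proof.
elim/poly_ind: p => // p t IH E.
rewrite comp_polyD comp_polyM comp_polyX comp_polyC in E.
have E' : 'X * ((1 + c *: 'X) * (p \Po ('X + c *: 'X^2))) + t%:P = 0.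
  rewrite -[RHS]E; congr (_ + _); rewrite mulrC -mulrA mulrCA; congr (_ * _).
  by rewrite mulrDl mul1r -scalerAl expr2.
have t0 : t = 0.
  have := congr1 (fun r : {poly R} => r`_0) E'.
  by rewrite coefD coefXM coefC add0r coef0.
move: E'; rewrite t0 addr0 => /eqP.
rewrite mulrC mulIr_eq0; last exact/monic_rreg/monicX.
move=> /eqP/poly_const1_regular/IH ->; first by rewrite mul0r addr0.
by rewrite coefD coefZ coefX coefC mulr0 addr0.
Qed.

Lemma linkage_descent (R : comNzRingType) (s t : R) (x y z X Y Z : {poly R}) :
    s *: (x * X * (y * z) - z * Z * (x * y)) =
      t *: (y * Y * (x * z) - z * Z * (x * y)) ->
  x * (y * z) * (s *: (X - Z) - t *: (Y - Z)) = 0.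
Proof.
move=> st; transitivity (s *: (x * X * (y * z) - z * Z * (x * y)) -
  t *: (y * Y * (x * z) - z * Z * (x * y))); last by rewrite st subrr.
by rewrite -!mul_polyC; ring.
Qed.

Lemma linkage_rearrange (R : comPzRingType) (s t x1 x2 y1 y2 z1 z2 : R) :
    s * (x1 - x2 - (z1 - z2)) = t * (y1 - y2 - (z1 - z2)) ->
  s * (x1 + (y2 + z2) - (z1 + (x2 + y2))) =
    t * (y1 + (x2 + z2) - (z1 + (x2 + y2))).
Proof.
move=> st; transitivity (s * (x1 - x2 - (z1 - z2))); first ring.
by rewrite st; ring.
Qed.

Section Pfister.
Variable F : fieldType.
Hypothesis F2 : (2 : F) != 0.
Implicit Types (a b c d : nonzero F) (C D G : seq (nonzero F)).
Implicit Types (X Y Z : seq (GW F)).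

Local Notation dpoly C := (pfpoly [seq pf1 c | c <- C]).

(** Padding with [<<1>> = 0] makes all lists equally long. *)
Lemma pf1_list X N : (forall x, x \in X -> is_pfister 1 x) -> (size X <= N)%N ->
  exists C, [/\ size C = N, pfpoly X = dpoly C &
    \sum_(x <- X) x = \sum_(c <- C) pf1 c].
Proof.
elim: X N => [|x X IH] N.
  move=> _ _; exists (nseq N (nonzero1 F)); rewrite size_nseq; split=> //.
    rewrite /pfpoly big_nil map_nseq pf1_1.
    elim: N => [|N IHN]; rewrite ?big_nil //.
    by rewrite big_cons scale0r addr0 mul1r -IHN.
  by rewrite big_nil big1_seq // => c /andP[_ /nseqP[-> _]]; apply: pf1_1.
case: N => // N XP sX; have [|C [sC CE sumC]] := IH N _ sX.
  by move=> y yX; apply: XP; rewrite inE yX orbT.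
have [|t xt] := XP x; first by rewrite inE eqxx.
have [c tc] := tuple1P t; exists (c :: C).
by rewrite /= sC !pfpoly_cons CE !big_cons sumC xt tc pfister1.
Qed.

Lemma pfpoly_nzN G :
  dpoly G * dpoly [seq nzN c | c <- G] = hyp_pol F ^+ size G.
Proof.
elim: G => [|g G IH]; first by rewrite /pfpoly big_nil mul1r.
rewrite /= !pfpoly_cons exprS -IH mulrACA; congr (_ * _).
rewrite linear_prod.
have -> : pf1 g + pf1 (nzN g) = pf1 (nzN1 F).
  transitivity (2 - (form1 g + form1 (nzN g))).
    by rewrite /pf1 form1_1; ring.
  by rewrite form1_hyperbolic // /pf1 form1_1; ring.
have -> : pf1 g * pf1 (nzN g) = 0.
  transitivity (1 - (form1 g + form1 (nzN g)) + form1 g * form1 (nzN g)).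
    by rewrite /pf1 form1_1; ring.
  by rewrite form1_hyperbolic // form1N mulrCA form1_square; ring.
by rewrite scale0r addr0.
Qed.

(** Let [C], [D], [G] be the lists of slots of [X], [Y], [Z].  Adding [- G] to [C]
   and to [D] turns the virtual forms [C - G] and [D - G] into actual ones, up to
   hyperbolic planes.  On generating polynomials this multiplies everything by
   the regular element [dpoly (- G)], because [dpoly G * dpoly (- G)] is the
   power of [hyp_pol] that [pfpoly_linkage] produces. *)
Lemma pfister1_linkage a b X Y Z :
    (forall x, x \in X ++ Y ++ Z -> is_pfister 1 x) ->
    pf1 a * (\sum_(x <- X) x - \sum_(x <- Z) x) =
      pf1 b * (\sum_(x <- Y) x - \sum_(x <- Z) x) ->
  pf1 a *: (pfpoly X - pfpoly Z) = pf1 b *: (pfpoly Y - pfpoly Z).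
Proof.
move=> XYZ; pose N := size (X ++ Y ++ Z).
have [||C [sC -> ->]] := @pf1_list X N.
- by move=> x xX; apply: XYZ; rewrite !mem_cat xX.
- by rewrite /N !size_cat leq_addr.
have [||D [sD -> ->]] := @pf1_list Y N.
- by move=> x xX; apply: XYZ; rewrite !mem_cat xX !orbT.
- by rewrite /N !size_cat addnCA leq_addr.
have [||G [sG -> ->]] := @pf1_list Z N.
- by move=> x xX; apply: XYZ; rewrite !mem_cat xX !orbT.
- by rewrite /N !size_cat addnA leq_addl.
pose G' := [seq nzN c | c <- G].
have sG' : size G' = N by rewrite size_map.
have sumG' : sumform G' = form1 (nzN1 F) * sumform G.
  by rewrite /sumform big_map mulr_sumr; apply: eq_bigr => c _; apply: form1N.
have anti t : pf1 t * form1 (nzN1 F) = - pf1 t.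
  apply/eqP; rewrite -addr_eq0 addrC -[X in X + _]mulr1 -mulrDr.
  by rewrite pf1_hyperbolic.
have sumE t H : size H = N ->
    pf1 t * sumform (H ++ G') =
      - (pf1 t * (\sum_(c <- H) pf1 c - \sum_(c <- G) pf1 c)).
  move=> sH; have := sum_pf1 H; have := sum_pf1 G.
  rewrite !big_map sH sG => -> ->.
  rewrite {1}/sumform big_cat -/(sumform H) -/(sumform G') sumG'.
  by rewrite mulrDr mulrA anti; ring.
move=> CD.
have := @pfpoly_linkage F F2 a b (C ++ G') (D ++ G').
rewrite !size_cat sC sD !sumE // CD => /(_ erefl erefl).
rewrite sG' addnn doubleK !map_cat !pfpoly_cat -sG -pfpoly_nzN -/G'.
move=> link; apply/eqP; rewrite -subr_eq0; apply/eqP.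
apply: (@poly_const1_regular _ (dpoly G')); first exact: (coef1_pfpoly _).1.
move/eqP: link; rewrite -subr_eq0 => /eqP link; rewrite -[RHS]link.
clear; move: (pf1 a) (pf1 b) => s t.
by rewrite -!mul_polyC rmorphB /=; ring.
Qed.

Lemma pf1_square b : pf1 b * pf1 b = 2 * pf1 b.
Proof.
transitivity (1 - form1 b *+ 2 + form1 b * form1 b).
  by rewrite /pf1 form1_1; ring.
by rewrite form1_square /pf1 form1_1; ring.
Qed.

Lemma pfister_square m x : is_pfister m x -> x * x = 2 ^+ m * x :> GW F.
Proof.
case=> t ->; rewrite /pfister.
elim: m t => [|m IH] t; first by rewrite tuple0 big_nil !mulr1.
case/tupleP: t => b t; rewrite big_cons mulrACA IH pf1_square exprS.
by rewrite -!mulrA; congr (_ * _); rewrite mulrCA.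
Qed.

Lemma pf1_pfister m b x : is_pfister m x -> is_pfister m.+1 (pf1 b * x).
Proof. by case=> t ->; exists [tuple of b :: t]; rewrite /pfister big_cons. Qed.

Definition quad m : {poly GW F} := 'X + 2 ^+ m *: 'X^2.

(** For [x = s <<b, c>>] take [y = s <<b>>], [z = s <<c>>] and [w = s <<b c>>],
   from [<<b>> + <<c>> = <<b c>> + <<b, c>>].  Moreover [w x = 0], and
   [y z = s ^ 2 <<b, c>> = 2 ^ m x]. *)
Lemma pfister_relation m x : is_pfister m.+2 x ->
  exists y z w, [/\ is_pfister m.+1 y, is_pfister m.+1 z, is_pfister m.+1 w,
    x = y + z - w &
    (1 + y *: 'X) * (1 + z *: 'X) = (1 + w *: 'X) * (1 + x *: quad m)].
Proof.
case=> t ->; case/tupleP: t => b t; case/tupleP: t => c t.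
rewrite /pfister !big_cons -[\prod_(_ <- _) _]/(pfister t).
have Pt : is_pfister m (pfister t) by exists t.
set s := pfister t in Pt *.
have bcD : pf1 b + pf1 c = pf1 (nzM b c) + pf1 b * pf1 c.
  by rewrite /pf1 form1M form1_1; ring.
have bcM : pf1 (nzM b c) * (pf1 b * pf1 c) = 0.
  transitivity (pf1 b * pf1 c - (form1 b * pf1 b) * (form1 c * pf1 c)).
    by rewrite {1}/pf1 form1M form1_1; ring.
  have form1_pf1 d : form1 d * pf1 d = - pf1 d.
    by rewrite /pf1 form1_1 mulrBr form1_square; ring.
  by rewrite !form1_pf1; ring.
exists (pf1 b * s), (pf1 c * s), (pf1 (nzM b c) * s); split.
- exact: pf1_pfister.
- exact: pf1_pfister.
- exact: pf1_pfister.
- by rewrite -mulrDl bcD; ring.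
rewrite linear_prod -mulrDl bcD mulrACA (pfister_square Pt) /quad.
rewrite [RHS]mulrDr mulr1 [X in _ = _ + X]mulrDl mul1r.
have -> : pf1 (nzM b c) * s *: 'X *
    (pf1 b * (pf1 c * s) *: ('X + 2 ^+ m *: 'X^2)) = 0.
  rewrite -scalerAl -scalerAr scalerA (_ : _ * _ * _ = 0) ?scale0r //.
  transitivity (pf1 (nzM b c) * (pf1 b * pf1 c) * (s * s)); first by ring.
  by rewrite bcM mul0r.
rewrite addr0 scalerDr scalerA mulrDl scalerDl -!mulrA !addrA.
by rewrite (mulrC s (2 ^+ m)).
Qed.

Lemma pfpoly_relation m X : (forall x, x \in X -> is_pfister m.+2 x) ->
  exists Y Z, [/\ forall y, y \in Y ++ Z -> is_pfister m.+1 y,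
    \sum_(x <- X) x = \sum_(y <- Y) y - \sum_(z <- Z) z &
    pfpoly Y = pfpoly Z * (pfpoly X \Po quad m)].
Proof.
elim: X => [|x X IH] XP.
  by exists [::], [::]; rewrite /pfpoly !big_nil subrr mul1r comp_polyC.
have [|Y [Z [YZP sumE polE]]] := IH.
  by move=> y yX; apply: XP; rewrite inE yX orbT.
have [|y [z [w [yP zP wP xE xpol]]]] := @pfister_relation m x.
  by apply: XP; rewrite inE eqxx.
exists [:: y, z & Y], (w :: Z); split.
- move=> u; rewrite /= !inE mem_cat inE.
  case/or4P=> [/eqP->|/eqP->|uY|/orP[/eqP->|uZ]] //.
    by apply: YZP; rewrite mem_cat uY.
  by apply: YZP; rewrite mem_cat uZ orbT.
- by rewrite !big_cons sumE xE; ring.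
rewrite !pfpoly_cons mulrA xpol polE rmorphM /=.
by rewrite comp_polyD comp_polyZ comp_polyX comp_polyC; ring.
Qed.

(** Induction on the number of slots.  By [pfpoly_relation] the generating
   polynomials of the three lists, after the substitution [quad m], are
   quotients of generating polynomials of lists with one slot less.  Neither
   clearing the common denominator nor the substitution loses information: the
   denominator has constant term 1, and [quad m] starts with ['X]. *)
Lemma pfister_linkage m a b X Y Z :
    (forall x, x \in X ++ Y ++ Z -> is_pfister m.+1 x) ->
    pf1 a * (\sum_(x <- X) x - \sum_(x <- Z) x) =
      pf1 b * (\sum_(x <- Y) x - \sum_(x <- Z) x) ->
  pf1 a *: (pfpoly X - pfpoly Z) = pf1 b *: (pfpoly Y - pfpoly Z).
Proof.
elim: m X Y Z => [|m IH] X Y Z XYZ XY; first exact: pfister1_linkage.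
have [x xX|X1 [X2 [XP sumX polX]]] := @pfpoly_relation m X.
  by apply: XYZ; rewrite !mem_cat xX.
have [x xY|Y1 [Y2 [YP sumY polY]]] := @pfpoly_relation m Y.
  by apply: XYZ; rewrite !mem_cat xY !orbT.
have [x xZ|Z1 [Z2 [ZP sumZ polZ]]] := @pfpoly_relation m Z.
  by apply: XYZ; rewrite !mem_cat xZ !orbT.
have := IH (X1 ++ Y2 ++ Z2) (Y1 ++ X2 ++ Z2) (Z1 ++ X2 ++ Y2).
rewrite !big_cat !pfpoly_cat /= polX polY polZ => link.
apply/eqP; rewrite -subr_eq0; apply/eqP.
apply: (@comp_poly_quad_eq0 _ (2 ^+ m)).
apply: (@poly_const1_regular _ (pfpoly (X2 ++ Y2 ++ Z2))).
  exact: (coef1_pfpoly _).1.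
rewrite !pfpoly_cat -/(quad m) comp_polyB !comp_polyZ !comp_polyB.
apply: (linkage_descent (link _ _)).
  move=> x; rewrite !mem_cat => H.
  have [] : [\/ x \in X1 ++ X2, x \in Y1 ++ Y2 | x \in Z1 ++ Z2].
    by rewrite !mem_cat; apply/or3P; move: H; do 6!case: (x \in _).
  - exact: XP.
  - exact: YP.
  exact: ZP.
by move: XY; rewrite sumX sumY sumZ; apply: linkage_rearrange.
Qed.

End Pfister.

(** * Powers of the fundamental ideal *)

Section FundPow.
Variable F : fieldType.
Implicit Types (x y : GW F).

Lemma fund_pow_add n x y : fund_pow n x -> fund_pow n y -> fund_pow n (x + y).
Proof.
case: n => //= n [s sP ->] [t tP ->]; exists (s ++ t); last by rewrite big_cat.
by move=> p; rewrite mem_cat => /orP[/sP|/tP].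
Qed.

Lemma fund_pow_opp n x : fund_pow n x -> fund_pow n (- x).
Proof.
case: n => //= n [s sP ->]; exists [seq (- p.1, p.2) | p <- s].
  move=> _ /mapP[p /sP[p0 pI] ->]; split=> //.
  by rewrite -[RHS]oppr0 -p0; apply: rmorphN.
by rewrite big_map -sumrN; apply: eq_bigr => p _; rewrite mulNr.
Qed.

Lemma fund_pow_pfister n x : is_pfister n x -> fund_pow n x.
Proof.
case=> t ->; elim: n t => //= n IH t; case/tupleP: t => a t.
exists [:: (pf1 a, pfister t)]; last by rewrite /pfister big_cons big_seq1.
by move=> p; rewrite inE => /eqP->; split; [apply: vdim_pf1 | apply: IH].
Qed.

Lemma fund_pow_sum n (X : seq (n.-tuple (nonzero F))) :
  fund_pow n (\sum_(t <- X) pfister t).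
Proof.
elim: X => [|t X IH]; rewrite ?big_nil ?big_cons; first exact: fund_pow0.
by apply: fund_pow_add => //; apply: fund_pow_pfister; exists t.
Qed.

Definition pfister_span n x := exists X Y : seq (n.-tuple (nonzero F)),
  x = \sum_(t <- X) pfister t - \sum_(t <- Y) pfister t.

Lemma pfister_span0 n : pfister_span n 0.
Proof. by exists [::], [::]; rewrite big_nil subrr. Qed.

Lemma pfister_spanD n x y :
  pfister_span n x -> pfister_span n y -> pfister_span n (x + y).
Proof.
case=> X [Y ->] [Z [T ->]]; exists (X ++ Z), (Y ++ T).
by rewrite !big_cat opprD addrACA.
Qed.

Lemma pfister_spanN n x : pfister_span n x -> pfister_span n (- x).
Proof. by case=> X [Y ->]; exists Y, X; rewrite opprB. Qed.

Lemma pfister_span_sum n (I : eqType) (s : seq I) (f : I -> GW F) :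
    (forall i, i \in s -> pfister_span n (f i)) ->
  pfister_span n (\sum_(i <- s) f i).
Proof.
move=> sP; rewrite big_seq; apply: big_ind => //; first exact: pfister_span0.
exact: pfister_spanD.
Qed.

Lemma pfister_spanM n a x : pfister_span n x -> pfister_span n.+1 (pf1 a * x).
Proof.
case=> X [Y ->]; pose cons_a (t : n.-tuple (nonzero F)) := [tuple of a :: t].
exists [seq cons_a t | t <- X], [seq cons_a t | t <- Y].
rewrite mulrBr !mulr_sumr !big_map.
by congr (_ - _); apply: eq_bigr => t _; rewrite /pfister big_cons.
Qed.

Lemma vdim_sumform (C : seq (nonzero F)) : vdim F (sumform C) = size C.
Proof.
rewrite /sumform; elim: C => [|c C IH]; first by rewrite big_nil [LHS]rmorph0.
by rewrite big_cons [LHS]rmorphD [vdim F (form1 c)]vdim_form1 [X in _ + X]IH.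
Qed.

(** Diagonalize both forms: in [<c_1> + ... - <d_1> - ...] the numbers of terms
   agree, so each [<c>] can be replaced by [- <<c>>]. *)
Lemma vdim0_pf1 x : (2 : F) != 0 -> vdim F x = 0 -> exists C D,
  x = \sum_(c <- C) pf1 c - \sum_(c <- D) pf1 c.
Proof.
move=> F2; elim/GW_ind: x => p q.
have [C ->] := diagonalization (qclass p) F2.
have [D ->] := diagonalization (qclass q) F2.
rewrite gdiffE !rmorph_sum /= -/(sumform C) -/(sumform D) => dimE.
have sCD : size C = size D.
  apply/eqP; rewrite -eqz_nat -!vdim_sumform -subr_eq0 -rmorphB; exact/eqP.
exists D, C; have := sum_pf1 C; have := sum_pf1 D; rewrite !big_map => -> ->.
by rewrite sCD; ring.
Qed.

Lemma fund_pow_span n x :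
  (2 : F) != 0 -> fund_pow n.+1 x -> pfister_span n.+1 x.
Proof.
move=> F2; elim: n x => [|n IH] x.
  case/fund_pow1/(vdim0_pf1 F2) => C [D ->].
  exists [seq [tuple c] | c <- C], [seq [tuple c] | c <- D].
  by rewrite !big_map; congr (_ - _); apply: eq_bigr => c _; rewrite pfister1.
case=> s sP ->; apply: pfister_span_sum => p.
move=> /sP[/(vdim0_pf1 F2)[C [D ->]] /IH pI].
rewrite mulrBl !mulr_suml; apply: pfister_spanD; last apply: pfister_spanN.
  by apply: pfister_span_sum => c _; apply: pfister_spanM.
by apply: pfister_span_sum => c _; apply: pfister_spanM.
Qed.

End FundPow.

(** * Expansion of invariants along sums of Pfister elements *)

(** By recursion rather than as coefficients of a polynomial, since the rings
   [A K] may be trivial. *)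
Fixpoint elemsym (R : pzRingType) (s : seq R) (d : nat) : R :=
  if s is x :: s' then
    elemsym s' d + (if d is d'.+1 then x * elemsym s' d' else 0)
  else (d == 0)%:R.

Lemma coef_pfpoly (F : fieldType) (X : seq (GW F)) d :
  (pfpoly X)`_d = elemsym X d.
Proof.
elim: X d => [|x X IH] d; first by rewrite /pfpoly big_nil coefC; case: d.
rewrite pfpoly_cons mulrDl mul1r -scalerAl coefD coefZ coefXM IH /=.
by case: d => [|d]; rewrite ?mulr0 ?IH.
Qed.

Section Invariants.
Variables (k : fieldType) (A : coefficients k).
Hypothesis char_k : 2%N \notin [pchar k].

Lemma extension_char (K : extension k) : (2 : K) != 0.
Proof.
rewrite -(rmorph_nat (ext_map K)) fmorph_eq0; apply: contra char_k => /eqP k2.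
by rewrite inE /= k2 eqxx.
Qed.

Lemma pfister_ones (K : extension k) n : (0 < n)%N ->
  pfister [tuple of nseq n (nonzero1 K)] = 0 /\
  symb A [tuple of nseq n (nonzero1 K)] = 0.
Proof.
case: n => // n _; rewrite /pfister /symb !big_cons pf1_1 f1_1.
by rewrite !mul0r.
Qed.

Section Shift.
Variable m : nat.
Hypothesis m0 : (0 < m)%N.

Definition In_add (K : extension k) (q r : In k m K) : In k m K :=
  exist _ (sval q + sval r) (fund_pow_add (svalP q) (svalP r)).

Definition In_pfister (K : extension k) (phi : Pf k m K) : In k m K :=
  exist _ (sval phi) (fund_pow_pfister (svalP phi)).

Lemma sf_map_In_add (K L : extension k) (s : ext_hom K L) (q r : In k m K) :
  sf_map s (In_add q r) = In_add (sf_map s q) (sf_map s r).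
Proof. by apply: subGW_eq; rewrite /= rmorphD. Qed.

Section OneInvariant.
Variable beta : Inv (In k m) A.

(** [y] is the divided difference of [beta] at [q]: the coefficient of [f_m] in
   the invariant [psi |-> beta (q + psi)] of m-fold Pfister elements. *)
Definition slope (K : extension k) (q : In k m K) (y : A K) : Prop :=
  forall (L : extension k) (s : ext_hom K L) (t : m.-tuple (nonzero L)),
    beta L (In_add (sf_map s q) (In_pfister (pfister_elt t))) =
      rf_map A s (beta K q) + rf_map A s y * symb A t.

Section Base.
Variables (K : extension k) (q : In k m K).

Definition shift_fun (L : extension K) (phi : Pf K m L) : A (restr_ext L) :=
  beta (restr_ext L) (In_add (sf_map (restr_init L) q)
    (In_pfister (phi : Pf k m (restr_ext L)))).

Lemma shift_fun_nat (L M : extension K) (s : ext_hom L M) phi :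
  shift_fun (sf_map s phi) = rf_map (restr_ring K A) s (shift_fun phi).
Proof.
rewrite /= /shift_fun -inv_nat sf_map_In_add.
congr (beta _ (In_add _ _)); last exact: subGW_eq.
have := @sf_map_comp _ (In k m) _ _ _ (restr_init L) (restr_hom s).
by move=> /(_ (restr_init M)) -> // x /=; rewrite ext_homP.
Qed.

Definition shift_inv : Inv (Pf K m) (restr_ring K A) :=
  @Invariant K (Pf K m) (restr_ring K A) shift_fun shift_fun_nat.

Definition base_slope (xy : A K * A K) : Prop :=
  forall (L : extension K) (t : m.-tuple (nonzero L)),
    shift_inv L (pfister_elt t) =
      rf_map A (restr_init L) xy.1 +
      rf_map A (restr_init L) xy.2 * symb A (K := restr_ext L) t.

(** Invariants over [K] live on extensions of [K]; here the formula is carried to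
   arbitrary morphisms out of [K]. *)
Lemma base_slopeP (L : extension k) (s : ext_hom K L) xy
    (t : m.-tuple (nonzero L)) :
  base_slope xy ->
  beta L (In_add (sf_map s q) (In_pfister (pfister_elt t))) =
      rf_map A s xy.1 + rf_map A s xy.2 * symb A t.
Proof.
move=> /(_ (over_ext s) t) /(congr1 (rf_map A (over_to s))).
rewrite /= /shift_fun -inv_nat sf_map_In_add rmorphD rmorphM.
have idE := @GW_map_id L (idfun : {rmorphism L -> L}) (fun x => erefl).
have -> : sf_map (over_to s)
    (In_pfister (pfister_elt t : Pf k m (restr_ext (over_ext s)))) =
    In_pfister (pfister_elt t : Pf k m L).
  by apply: subGW_eq; rewrite /= idE.
have -> : sf_map (over_to s) (sf_map (restr_init (over_ext s)) q) = sf_map s q.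
  by apply/esym/sf_map_comp.
move=> ->; congr (_ + _ * _); try by apply/esym/rf_map_comp.
rewrite /symb rmorph_prod; apply: eq_bigr => c _ /=; rewrite -f1_nat.
by congr (f1 A _); apply: subGW_eq; rewrite /= idE.
Qed.

Lemma In_add_pf_trivial (L : extension k) (r : In k m L) :
  In_add r (In_pfister (pfister_elt [tuple of nseq m (nonzero1 L)])) = r
  /\ symb A [tuple of nseq m (nonzero1 L)] = 0.
Proof.
split; last by rewrite (pfister_ones L m0).2.
by apply: subGW_eq; rewrite /= (pfister_ones L m0).1 addr0.
Qed.

(** The constant term is found at [psi = <<1, ..., 1>> = 0]. *)
Lemma base_slope_init xy : base_slope xy -> xy.1 = beta K q.
Proof.
move=> xyP; pose i := @ExtHom k K K (idfun : {rmorphism K -> K}) (fun=> erefl).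
have := base_slopeP i [tuple of nseq m (nonzero1 K)] xyP.
have [-> ->] := In_add_pf_trivial (sf_map i q).
by rewrite mulr0 addr0 (@sf_map_id _ (In k m) _ i) // (@rf_map_id _ A _ i).
Qed.

Lemma slope_exists : exists! y, slope q y.
Proof.
have [[x y] [xyP xyU]] := coef_inv m0 shift_inv.
have xE := base_slope_init xyP; rewrite /= in xE.
exists y; split=> [L s t|z zP]; first by rewrite (base_slopeP s t xyP) /= xE.
have : (x, y) = (beta K q, z).
  by apply: xyU => L t; exact: (zP (restr_ext L) (restr_init L) t).
by case.
Qed.
End Base.

Definition Phi_fun (K : extension k) (q : In k m K) : A K :=
  sval (cid (slope_exists q)).

Lemma Phi_funP (K : extension k) (q : In k m K) : slope q (Phi_fun q).
Proof. by rewrite /Phi_fun; case: cid => y []. Qed.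

Lemma Phi_fun_nat (K L : extension k) (s : ext_hom K L) (q : In k m K) :
  Phi_fun (sf_map s q) = rf_map A s (Phi_fun q).
Proof.
have [y [_ yU]] := slope_exists (sf_map s q).
rewrite -(yU _ (Phi_funP _)); apply: yU => M t u.
have [v vE] : exists v : ext_hom K M, v =1 t \o s.
  have c x : t (s (ext_map K x)) = ext_map M x by rewrite !ext_homP.
  by exists (@ExtHom k K M (t \o s : {rmorphism K -> M}) c).
have -> : sf_map t (sf_map s q) = sf_map v q by apply/esym/sf_map_comp.
rewrite Phi_funP inv_nat.
by congr (_ + _ * _); apply: rf_map_comp.
Qed.

Definition Phi : Inv (In k m) A := Invariant Phi_fun_nat.

Lemma PhiP (K : extension k) (q r : In k m K) (t : m.-tuple (nonzero K)) :
    sval r = sval q + pfister t ->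
  beta K r = beta K q + symb A t * Phi K q.
Proof.
move=> rE; pose i := @ExtHom k K K (idfun : {rmorphism K -> K}) (fun=> erefl).
have := Phi_funP q i t.
rewrite (@sf_map_id _ (In k m) _ i) // !(@rf_map_id _ A _ i) // mulrC => <-.
by congr (beta _ _); apply: subGW_eq.
Qed.
End OneInvariant.

(** Iterate [PhiP]: removing one Pfister element [psi] from the sum corresponds to
   the recursion [e_d (psi, X) = e_d (X) + psi e_(d-1) (X)]. *)
Lemma inv_expansion (beta : Inv (In k m) A) (K : extension k) (q r : In k m K)
    (X : seq (m.-tuple (nonzero K))) n :
    sval r = sval q + \sum_(t <- X) pfister t -> (size X <= n)%N ->
  beta K r =
    \sum_(d < n.+1) iter d Phi beta K q * elemsym [seq symb A t | t <- X] d.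
Proof.
elim: X beta r n => [|t X IH] beta r n.
  rewrite big_nil addr0 => rq _; rewrite big_ord_recl /= mulr1 big1 ?addr0.
    by congr (beta _ _); apply: subGW_eq.
  by move=> i _; rewrite mulr0.
case: n => // n rE sX.
pose r' : In k m K := exist _ (sval q + \sum_(t <- X) pfister t)
  (fund_pow_add (svalP q) (fund_pow_sum X)).
rewrite (@PhiP beta K r' r t); last by rewrite rE big_cons /= addrAC addrA.
rewrite (IH beta r' n.+1) ?(IH (Phi beta) r' n) //; last exact: leqW.
under [in RHS]eq_bigr do rewrite /= mulrDr.
rewrite big_split /=; congr (_ + _); rewrite [RHS]big_ord_recl /= mulr0 add0r.
rewrite mulr_sumr; apply: eq_bigr => d _.
by rewrite /bump /= -iterSr /= mulrCA.
Qed.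
End Shift.

(** * Surjectivity *)

(** The morphism [f_N], as a function on the whole ring so that it applies to
   products and sums without membership proofs. *)
Definition extends_symb (K : extension k) N (g : GW K -> A K) :=
  (forall x y, fund_pow N x -> fund_pow N y -> g (x + y) = g x + g y) /\
  (forall t : N.-tuple (nonzero K), g (pfister t) = symb A t).

Lemma extends_symb_exists (K : extension k) N : (0 < N)%N ->
  exists g : GW K -> A K, extends_symb N g.
Proof.
move=> N0; have [f [fD _ ft]] := coef_fn A K N0.
exists (fun x =>
  if pselect (fund_pow N x) is left xI then f (exist _ x xI) else 0).
split=> [x y xI yI|t].
  have xyI := fund_pow_add xI yI.
  do 3!(case: pselect => // ?).
  exact: fD.
have tI : fund_pow N (pfister t) by apply: fund_pow_pfister; exists t.
by case: pselect => // ?; apply: ft.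
Qed.

(** A product of Pfister elements is a Pfister element with more slots, so [f_N]
   turns symmetric functions of Pfister elements into those of symbols. *)
Lemma symb_elemsym (K : extension k) m (X : seq (m.-tuple (nonzero K))) d r
    (s : r.-tuple (nonzero K)) (g : GW K -> A K) :
    extends_symb (r + d * m) g ->
  fund_pow (r + d * m) (pfister s * elemsym [seq pfister t | t <- X] d) /\
  g (pfister s * elemsym [seq pfister t | t <- X] d) =
    symb A s * elemsym [seq symb A t | t <- X] d.
Proof.
case=> gD gs; have g0 : g 0 = 0.
  by apply: (addrI (g 0)); rewrite -gD ?addr0 //; apply: fund_pow0.
elim: X d r s gD gs g0 => [|t X IH] d r s gD gs g0.
  case: d gD gs g0 => [|d] gD gs g0 /=.
    2: by rewrite !mulr0; split=> //; apply: fund_pow0.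
  rewrite !mulr1; move: gs; rewrite mul0n addn0 => gs; split=> //.
  by apply: fund_pow_pfister; exists s.
have [I1 E1] := IH d r s gD gs g0.
case: d gD gs I1 E1 => [|d] gD gs I1 E1 /=; first by rewrite !addr0.
rewrite !mulrDr !mulrA.
pose st := [tuple of s ++ t].
have -> : pfister s * pfister t = pfister st by rewrite /pfister big_cat.
have -> : symb A s * symb A t = symb A st by rewrite /symb big_cat.
have NE : (r + d.+1 * m = r + m + d * m)%N by rewrite mulSn addnA.
move: gD gs I1 E1; rewrite NE => gD gs I1 E1.
have [I2 E2] := IH d (r + m)%N st gD gs g0.
by split; [exact: fund_pow_add | rewrite gD // E1 E2].
Qed.

Lemma symb_linkage (K : extension k) m (a b : nonzero K)
    (X Y Z : seq (m.-tuple (nonzero K))) d :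
    let p T := elemsym [seq pfister t | t <- T] d in
    let s T := elemsym [seq symb A t | t <- T] d in
    pf1 a * (p X - p Z) = pf1 b * (p Y - p Z) ->
  f1 A (pf1_I a) * (s X - s Z) = f1 A (pf1_I b) * (s Y - s Z).
Proof.
move=> p s; have [g gP] := extends_symb_exists K (isT : 0 < 1 + d * m)%N.
have gE c (T : seq (m.-tuple (nonzero K))) :
    fund_pow (1 + d * m) (pf1 c * elemsym [seq pfister t | t <- T] d) /\
    g (pf1 c * elemsym [seq pfister t | t <- T] d) =
      f1 A (pf1_I c) * elemsym [seq symb A t | t <- T] d.
  by have := symb_elemsym T [tuple c] gP; rewrite pfister1 /symb big_seq1.
rewrite !mulrBr => /eqP; rewrite subr_eq addrAC eq_sym subr_eq => /eqP E.
apply/eqP; rewrite subr_eq addrAC eq_sym subr_eq -!(gE _ _).2.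
by rewrite -!gP.1 ?E //; apply: (gE _ _).1.
Qed.

(** What makes [phi q |-> f_1 (phi) beta (q)] well defined.  With [q = X - Y] and
   [r = X' - Y'] in terms of Pfister elements and [y = Y + Y'], the elements [q],
   [r] and [0] are obtained from [- y] by adding the Pfister elements of [X + Y'],
   [X' + Y] and [Y + Y'].  As [beta (0) = 0], the expansions of [beta (q)] and
   [beta (r)] at [- y] can be replaced by differences with the one of [beta (0)],
   to which the linkage of symmetric functions applies degree by degree. *)
Lemma inv_value_linkage m (beta : InvNorm (In k m) A) (K : extension k)
    (a b : nonzero K) (q r : In k m K) : (0 < m)%N ->
    pf1 a * sval q = pf1 b * sval r ->
  f1 A (pf1_I a) * beta K q = f1 A (pf1_I b) * beta K r.
Proof.
case: m beta q r => // m beta q r m0 qr.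
have K2 := extension_char K.
have [X [Y qE]] := fund_pow_span K2 (svalP q).
have [X' [Y' rE]] := fund_pow_span K2 (svalP r).
pose y := \sum_(t <- Y ++ Y') pfister t.
have yI : fund_pow m.+1 (- y) by apply/fund_pow_opp/fund_pow_sum.
pose Q : In k m.+1 K := exist _ (- y) yI.
pose n := size (X ++ X' ++ Y ++ Y').
pose S (Z : seq (m.+1.-tuple (nonzero K))) :=
  \sum_(d < n.+1) iter d (Phi m0) beta K Q * elemsym [seq symb A t | t <- Z] d.
have expand (Z : seq (m.+1.-tuple (nonzero K))) (p : In k m.+1 K) :
    sval p = - y + \sum_(t <- Z) pfister t -> (size Z <= n)%N ->
  beta K p = S Z.
  exact: (@inv_expansion _ m0 beta K Q p Z n).
have bq : beta K q = S (X ++ Y').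
  by apply: expand; rewrite /n ?size_cat ?qE /y ?big_cat /=; [ring | lia].
have br : beta K r = S (X' ++ Y).
  by apply: expand; rewrite /n ?size_cat ?rE /y ?big_cat /=; [ring | lia].
have b0 : 0 = S (Y ++ Y').
  rewrite -(inv_normP beta K); apply: expand; first by rewrite addNr.
  by rewrite /n !size_cat; lia.
rewrite -[beta K q]subr0 -[beta K r]subr0 bq br b0 /S -!sumrB !mulr_sumr.
apply: eq_bigr => d _; rewrite -!mulrBr mulrCA [RHS]mulrCA; congr (_ * _).
apply: symb_linkage.
have := @pfister_linkage K K2 m a b
  [seq pfister t | t <- X ++ Y'] [seq pfister t | t <- X' ++ Y]
  [seq pfister t | t <- Y ++ Y'].
move=> link; rewrite -!coef_pfpoly -!coefB -!coefZ link //.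
  move=> x; rewrite -!map_cat => /mapP[t _ ->]; by exists t.
rewrite !big_map !big_cat /=.
move: qr; rewrite qE rE => qr.
transitivity (pf1 a * (\sum_(t <- X) pfister t - \sum_(t <- Y) pfister t)).
  by ring.
by rewrite qr; ring.
Qed.

End Invariants.

Section Surjectivity.
Variables (k : fieldType) (A : coefficients k) (n : nat).
Hypotheses (char_k : 2%N \notin [pchar k]) (n_ge2 : (2 <= n)%N).

Lemma Inr1P (K : extension k) (x : Inr k n 1 K) :
  exists phi q, x = Pf1_mul phi q.
Proof.
case: (svalP x) => t [q [qI xE]].
exists (pfister_elt t), (exist _ q qI); exact: subGW_eq.
Qed.

Section Lift.
Variable beta : InvNorm (In k (n - 1)) A.

Lemma lift_exists (K : extension k) (x : Inr k n 1 K) :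
  exists z : A K, forall phi q,
    x = Pf1_mul phi q -> z = f1 A (Pf1_I phi) * beta K q.
Proof.
have Pf1_IE (phi : Pf k 1 K) c : sval phi = pf1 c -> Pf1_I phi = pf1_I c.
  by move=> E; apply: subGW_eq.
have [phi [q xE]] := Inr1P x; exists (f1 A (Pf1_I phi) * beta K q) => psi r xE'.
have [a phiE] := Pf1P phi; have [b psiE] := Pf1P psi.
rewrite (Pf1_IE _ _ phiE) (Pf1_IE _ _ psiE); apply: inv_value_linkage => //.
  by rewrite subn_gt0.
by rewrite -phiE -psiE; move/(congr1 sval): xE'; rewrite xE.
Qed.

Definition lift_fun (K : extension k) (x : Inr k n 1 K) : A K :=
  sval (cid (lift_exists x)).

Lemma lift_funE (K : extension k) (phi : Pf k 1 K) q :
  lift_fun (Pf1_mul phi q) = f1 A (Pf1_I phi) * beta K q.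
Proof. by rewrite /lift_fun; case: cid => z /= zP; exact: zP. Qed.

Lemma lift_fun_nat (K L : extension k) (s : ext_hom K L) (x : Inr k n 1 K) :
  lift_fun (sf_map s x) = rf_map A s (lift_fun x).
Proof.
have [phi [q ->]] := Inr1P x.
rewrite sf_map_Pf1_mul !lift_funE inv_nat rmorphM -f1_nat.
by congr (f1 A _ * _); apply: subGW_eq.
Qed.

Lemma lift_fun_norm (K : extension k) : lift_fun (pf_point (Inr k n 1) K) = 0.
Proof.
have [phi [_ _]] := Inr1P (pf_point (Inr k n 1) K).
have -> : pf_point (Inr k n 1) K = Pf1_mul phi (pf_point (In k (n - 1)) K).
  by apply: subGW_eq; rewrite /= mulr0.
by rewrite lift_funE inv_normP mulr0.
Qed.

Definition lift : InvNorm (Inr k n 1) A :=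
  @NormInvariant k (Inr k n 1) A
    (@Invariant k (Inr k n 1) A lift_fun lift_fun_nat) lift_fun_norm.

Lemma lift_Delta : Delta lift = beta.
Proof. by apply/esym/Delta_unique => K phi q; apply: lift_funE. Qed.
End Lift.

Lemma Delta_inj (alpha alpha' : InvNorm (Inr k n 1) A) :
  Delta alpha = Delta alpha' -> alpha = alpha'.
Proof.
move=> E; apply: InvNorm_eq => K x; have [phi [q ->]] := Inr1P x.
by rewrite (DeltaP alpha) (DeltaP alpha') E.
Qed.
End Surjectivity.

Theorem proposition1p2p88 (k : fieldType) (char_k : 2%N \notin [pchar k])
    (A : coefficients k) (n : nat) (n_ge2 : (2 <= n)%N) :
  [/\ forall alpha beta : InvNorm (Inr k n 1) A,
        Delta (inv_norm_add alpha beta) =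
        inv_norm_add (Delta alpha) (Delta beta),
      forall (c : A (trivial_ext k)) (alpha : InvNorm (Inr k n 1) A),
        Delta (inv_norm_scale c alpha) = inv_norm_scale c (Delta alpha) &
      bijective (@Delta k A n : InvNorm (Inr k n 1) A ->
                                InvNorm (In k (n - 1)) A)].
Proof.
split.
- move=> alpha beta; apply/esym/Delta_unique => K phi q.
  by rewrite /= (DeltaP alpha) (DeltaP beta) mulrDr.
- move=> c alpha; apply/esym/Delta_unique => K phi q.
  by rewrite /= (DeltaP alpha) mulrCA.
exists (lift char_k n_ge2) => alpha; last exact: lift_Delta.
by apply: Delta_inj; apply: lift_Delta.
Qed.
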